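(* Let $H$ be a positive definite hermitian $n\times n$ matrix and let $D_H=\{z\in\mathbb{C}^n : \overline z^{T}Hz<1\}$. Then for every compact set $A\subset\partial D_H$ and all $z\in D_H$, $$\omega(z,A,D_H)=\omega^n(z,A,D_H)=\omega^R(z,A,D_H)=\omega^c(z,A,D_H).$$
   Context: For a domain $D\subset\mathbb{C}^n$, $\mathrm{PSH}(D)^-$ denotes the family of non-positive plurisubharmonic functions on $D$. For $u\in\mathrm{PSH}(D)^-$ and $z\in\overline D$, $u^*(z)=\limsup_{\zeta\to z,\ \zeta\in D}u(\zeta)$. A domain $D$ is strongly star shaped with respect to the origin if $r\overline D\subset D$ for all $r\in\,]0,1[$ (the domains $D_H$ have this property). For a bounded domain $D$ with smooth boundary that is strongly star shaped with respect to the origin, a set $A\subset\partial D$ and $z\in D$, the boundary relative extremal functions are: - $\omega^c(z,A,D)=\sup\{u(z): u\in\mathrm{PSH}(D)^-\cap C(\overline D),\ u\le -1 \text{ on } A\}$; - $\omega(z,A,D)=\sup\{u(z): u\in\mathrm{PSH}(D)^-,\ u^*\le -1 \text{ on } A\}$; - $\omega^n(z,A,D)=\sup\{u(z): u\in\mathrm{PSH}(D)^-,\ \limsup_{y\to\zeta,\ y\in n_\zeta}u(y)\le -1 \text{ for all }\zeta\in A\}$, where $n_\zeta$ is the inward normal to $\partial D$ at $\zeta$; - $\omega^R(z,A,D)=\sup\{u(z): u\in\mathrm{PSH}(D)^-,\ \limsup_{r\to1^-}u(r\zeta)\le -1 \text{ for all }\zeta\in A\}$. Here the superscript $n$ in $\omega^n$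 stands for ''normal'' and is not the dimension. *)

(* Defs.v *)
From HB Require Import structures.
From mathcomp Require Import all_boot all_order all_algebra.
From mathcomp Require Import spectral complex.
From mathcomp Require Import all_classical all_reals all_analysis.

Set Implicit Arguments.
Unset Strict Implicit.
Unset Printing Implicit Defensive.

Import Order.TTheory GRing.Theory Num.Theory numFieldNormedType.Exports.

Local Open Scope classical_set_scope.
Local Open Scope ring_scope.
Local Open Scope complex_scope.
Local Open Scope sesquilinear_scope.

(* mathcomp-analysis equips every K : numClosedFieldType with the normed-module
   structure of K^o, but that instance is keyed on an abstract K and is not
   found for the type R[i]. *)
HB.instance Definition _ (R : realType) := NormedModule.copy R[i] R[i]^o.

Section extremal_functions.
Context {R : realType}.

(* The topology of 'cV[R[i]]_n is that of the sup norm, i.e. the usual one. *)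

(* Functions are total; the values of v outside Omega play no role. *)
Definition usc_on (X : topologicalType) (Omega : set X) (v : X -> \bar R) :=
  lower_semicontinuous ((fun x => - v x)%E : subspace Omega -> \bar R).

(* The function identically -oo is allowed; since the constant -1 belongs to
   each of the four families below, this has no effect on their suprema. *)
Definition subharmonic (Omega : set R[i]) (v : R[i] -> \bar R) :=
  [/\ usc_on Omega v,
      forall c, Omega c -> (v c < +oo)%E &
      forall (c : R[i]) (r : R), 0 < r ->
        [set w : R[i] | `|w - c| <= r%:C] `<=` Omega ->
        (v c <= ((2 * pi)^-1)%:E *
          \int[lebesgue_measure]_(t in `[0%R, (2 * pi)%R])
            v (c + r%:C * (cos t +i* sin t))%R)%E].

Context {n : nat}.
Local Notation V := 'cV[R[i]]_n.

Definition plurisubharmonic (D : set V) (u : V -> \bar R) :=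
  usc_on D u /\
  forall a b : V, D a ->
    subharmonic [set l : R[i] | D (a + l *: b)] (fun l => u (a + l *: b)).

Definition psh_nonpos (D : set V) : set (V -> \bar R) :=
  [set u | plurisubharmonic D u /\ forall z, D z -> (u z <= 0)%E].

Definition boundary (D : set V) : set V := closure D `\` D°.

Definition usc_reg (D : set V) (u : V -> \bar R) (z : V) : \bar R :=
  limf_esup u (within D (nbhs z)).

(* Gradient for the real inner product Re (g^* h) on C^n = R^2n. *)
Definition is_gradient (rho : V -> R) (z g : V) :=
  (rho (z + h) - rho z - complex.Re ((g^t* *m h) ord0 ord0))%:C / `|h|
    @[h --> (0 : V)^'] --> (0 : R[i]).

Definition local_defining_function (D : set V) (zeta : V)
    (rho : V -> R) (grad : V -> V) :=
  [/\ \forall z \near zeta, is_gradient rho z (grad z),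
      \forall z \near zeta, {for z, continuous grad},
      rho zeta = 0, grad zeta != 0 &
      \forall z \near zeta, D z <-> rho z < 0].

(* The open half-line from zeta in the direction -grad rho (zeta), which does
   not depend on the C^1 local defining function rho. *)
Definition inward_normal (D : set V) (zeta : V) : set V :=
  [set y | exists rho grad, local_defining_function D zeta rho grad /\
     exists2 t : R, 0 < t & y = zeta - t%:C *: grad zeta].

Definition omega (z : V) (A D : set V) : \bar R :=
  ereal_sup [set u z | u in [set u | psh_nonpos D u /\
    forall zeta, A zeta -> (usc_reg D u zeta <= (-1)%:E)%E]].

Definition omega_n (z : V) (A D : set V) : \bar R :=
  ereal_sup [set u z | u in [set u | psh_nonpos D u /\
    forall zeta, A zeta ->
      (limf_esup u (within (D `&` inward_normal D zeta) (nbhs zeta))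
         <= (-1)%:E)%E]].

Definition omega_R (z : V) (A D : set V) : \bar R :=
  ereal_sup [set u z | u in [set u | psh_nonpos D u /\
    forall zeta, A zeta ->
      (limf_esup (fun r : R => u (r%:C *: zeta)) (1 : R)^'- <= (-1)%:E)%E]].

Definition omega_c (z : V) (A D : set V) : \bar R :=
  ereal_sup [set (u z)%:E | u in [set u : V -> R |
    [/\ psh_nonpos D (EFin \o u), {within closure D, continuous u} &
        forall zeta, A zeta -> u zeta <= -1]]].

Definition posdef (H : 'M[R[i]]_n) :=
  H \is hermsymmx /\
  forall z : V, z != 0 -> 0 < (z^t* *m H *m z) ord0 ord0.

Definition ellipsoid (H : 'M[R[i]]_n) : set V :=
  [set z | (z^t* *m H *m z) ord0 ord0 < 1].

End extremal_functions.

(* Main.v *)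
Require Import Defs.
From mathcomp Require Import all_boot all_order all_algebra.
From mathcomp Require Import spectral complex.
From mathcomp Require Import all_classical all_reals all_analysis.
From mathcomp Require Import measurable_realfun.
From mathcomp Require Import ring lra.
Import Order.TTheory GRing.Theory Num.Theory numFieldNormedType.Exports.
Local Open Scope classical_set_scope.
Local Open Scope ring_scope.
Local Open Scope complex_scope.

(* Each of the three larger functions is bounded by omega^c along linear maps
   T_t = 1 - tB (B = 1 for radii, B = H for normals), which are contractions for
   the norm defining the ellipsoid. Let u be a competitor truncated to [-1, 0].
   The functions u o T_t are plurisubharmonic near the closed ellipsoid and their
   limsup as t -> 0 is at most -1 on A. Simons' inequality (in place of Edwards'
   duality theorem) gives convex combinations that are at most -1 + e uniformly
   on A, and a sup-convolution makes them continuous. The value at z is not lost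
   because a real segment is not thin at its end point, so that
   limsup u(T_t z) >= u(z). *)

Set Implicit Arguments.
Unset Strict Implicit.
Unset Printing Implicit Defensive.

(** * Real-valued norms and circle means *)

(** The limsup conditions on [A] are pointwise, with no rate common to all points of [A], so no
    single [u \o T_t] need be small on all of [A]. Plurisubharmonicity survives convex combinations,
    and this is what makes a passage to uniform bounds possible. Contraction gives room: [T_t] sends
    a strictly larger ellipsoid into the given one, so the new functions live on a neighbourhood of
    the closure, where a sup-convolution may move points by a small distance and yields continuity
    up to the boundary. Upper semicontinuity bounds limsup [u(T_t z)] only from above by [u(z)]. The
    bound from below uses subharmonicity on the complex line through [z] in the direction [B z], by
    comparison with an explicit barrier. Ellipsoids enter through their normals: the gradient of the
    quadratic form at [zeta] is [2 H zeta], so all inward normals are traced by one family of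
    complex linear maps [1 - tH], and composition with these preserves plurisubharmonicity. *)

Section real_norm.
Context {R : realType} {W : normedModType R[i]}.
Implicit Types x y : W.

(** Norms here take values in [R[i]], which is only partially ordered; the real copy allows
    estimates in the ordered field [R]. *)
Definition rnorm x : R := complex.Re `|x|.

Lemma rnormE x : `|x| = (rnorm x)%:C.
Proof.
have := normr_ge0 x; rewrite /rnorm; case: `|x| => a b; rewrite lecE /=.
by move=> /andP[/eqP->].
Qed.

Lemma rnorm_ge0 x : 0 <= rnorm x.
Proof. by have := normr_ge0 x; rewrite rnormE lecR. Qed.

Lemma rnormD x y : rnorm (x + y) <= rnorm x + rnorm y.
Proof. by have := ler_normD x y; rewrite !rnormE -rmorphD lecR. Qed.

Lemma rnorm0 : rnorm (0 : W) = 0.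
Proof. by rewrite /rnorm normr0. Qed.

Lemma rnorm0_eq x : rnorm x = 0 -> x = 0.
Proof. by move=> x0; apply/eqP; rewrite -normr_eq0 rnormE x0. Qed.

Lemma rnormN x : rnorm (- x) = rnorm x.
Proof. by rewrite /rnorm normrN. Qed.

Lemma rnormB x y : rnorm (x - y) = rnorm (y - x).
Proof. by rewrite -rnormN opprB. Qed.

Lemma Re_normZ (l : R[i]) x : rnorm (l *: x) = complex.Re `|l| * rnorm x.
Proof.
rewrite {1}/rnorm normrZ rnormE.
rewrite (_ : `|l| = (complex.Re `|l|)%:C) -?rmorphM//=.
Qed.

Lemma nbhs_rnormP x (U : set W) :
  nbhs x U <-> exists2 e : R, 0 < e & forall y, rnorm (y - x) < e -> U y.
Proof.
split=> [/nbhs_ballP|].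
- move=> [e /= e0 eU]; have [a ea] : exists a : R, e = a%:C.
    by move: e0; case: (e) => a b; rewrite ltcE /= => /andP[/eqP-> _]; exists a.
  exists a; first by move: e0; rewrite ea ltcR.
  move=> y ya; apply: eU; rewrite -ball_normE /ball_ /= distrC rnormE ea ltcR//.
- move=> [e e0 eU]; apply/nbhs_ballP; exists e%:C; first by rewrite /= ltcR.
  by move=> y; rewrite -ball_normE /ball_ /= distrC rnormE ltcR => /eU.
Qed.

End real_norm.

Lemma rnormZ {R : realType} {W : normedModType R[i]} (l : R[i]) (x : W) :
  rnorm (l *: x) = rnorm l * rnorm x.
Proof. exact: Re_normZ. Qed.



Lemma le_mx_norm_entry (K : numDomainType) m n (v : 'M[K]_(m,n)) i j : `|v i j| <= mx_norm v.
Proof.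
rewrite mx_normE -[leLHS]nngE num_le.
exact: (le_bigmax _ (fun ij => `|v ij.1 ij.2|%:nng) (i, j)).
Qed.
Lemma mx_norm_delta_le1 (K : numDomainType) m n i j : mx_norm (delta_mx i j : 'M[K]_(m,n)) <= 1.
Proof.
rewrite mx_normE -[leRHS]nngE num_le.
apply/bigmax_leP; split => [|ij _].
    by rewrite -[_ <= _]num_le /= ler01.
  by rewrite -[_ <= _]num_le /= !mxE; case: (_ && _); rewrite ?normr1 ?normr0 ?ler01.
Qed.

Section circle_means.
Context {R : realType}.
Implicit Types (f g : R[i] -> R) (l : R[i]).
Local Notation mu := (@lebesgue_measure R).

Lemma rnorm_coord (n : nat) (v : 'cV[R[i]]_n) i j : rnorm (v i j) <= rnorm v.
Proof.
rewrite -lecR -!rnormE [leRHS]/Num.norm/= mx_normE.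
exact: le_mx_norm_entry.
Qed.

Lemma rnorm_col (n : nat) (v : 'cV[R[i]]_n) :
  rnorm v <= \sum_i rnorm (v i ord0).
Proof.
have {1}-> : v = \sum_i (v i ord0) *: delta_mx i ord0.
  apply/colP => i; rewrite summxE (bigD1 i)//= big1 ?addr0.
    by rewrite !mxE !eqxx mulr1.
  by move=> k ki; rewrite !mxE eq_sym (negbTE ki) mulr0.
have d1 (i : 'I_n) : rnorm (delta_mx i ord0 : 'cV[R[i]]_n) <= 1.
  by rewrite -lecR -rnormE; exact: mx_norm_delta_le1.
elim/big_ind2 : _ => [|x a y b xa yb|i _]; first by rewrite rnorm0.
  by rewrite (le_trans (rnormD _ _))// lerD.
by rewrite rnormZ ler_piMr// rnorm_ge0.
Qed.

Lemma rnormCE l : rnorm l = Num.sqrt (complex.Re l ^+ 2 + complex.Im l ^+ 2).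
Proof. by rewrite /rnorm; case: l. Qed.

Lemma rnormC_sqr l : rnorm l ^+ 2 = complex.Re l ^+ 2 + complex.Im l ^+ 2.
Proof. by rewrite rnormCE sqr_sqrtr// addr_ge0// sqr_ge0. Qed.

Lemma rnormM l l' : rnorm (l * l') = rnorm l * rnorm l'.
Proof. by rewrite -[l * l']/(l *: (l' : R[i]^o)) rnormZ. Qed.

Lemma rnormX l k : rnorm (l ^+ k) = rnorm l ^+ k.
Proof.
elim: k => [|k ih]; first by rewrite !expr0 /rnorm normr1.
by rewrite !exprS rnormM ih.
Qed.

Lemma rnormV l : rnorm l^-1 = (rnorm l)^-1.
Proof.
have [->|l0] := eqVneq l 0; first by rewrite invr0 rnorm0 invr0.
apply: (@mulfI _ (rnorm l)); first by apply: contra l0 => /eqP/rnorm0_eq ->.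
rewrite -rnormM !mulfV ?/rnorm ?normr1//.
by apply: contra l0 => /eqP/rnorm0_eq ->.
Qed.

Lemma rnorm_real (r : R) : rnorm r%:C = `|r|.
Proof. by rewrite rnormCE /= expr0n addr0 sqrtr_sqr. Qed.

Lemma Re_le_rnorm l : `|complex.Re l| <= rnorm l.
Proof.
by rewrite rnormCE -[leLHS]sqrtr_sqr ler_wsqrtr// lerDl sqr_ge0.
Qed.

Lemma Im_le_rnorm l : `|complex.Im l| <= rnorm l.
Proof. by rewrite rnormCE -[leLHS]sqrtr_sqr ler_wsqrtr// lerDr sqr_ge0. Qed.

Lemma rnorm_le_ReIm l : rnorm l <= `|complex.Re l| + `|complex.Im l|.
Proof.
rewrite -(@ler_pXn2r _ 2)// ?nnegrE ?rnorm_ge0 ?addr_ge0//.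
rewrite rnormC_sqr sqrrD !real_normK ?num_real//.
rewrite lerD2r lerDl mulrn_wge0// mulr_ge0//.
Qed.

Definition cis (t : R) : R[i] := cos t +i* sin t.

Lemma rnorm_cis t : rnorm (cis t) = 1.
Proof. by rewrite rnormCE /= cos2Dsin2 sqrtr1. Qed.

Lemma cis_near t (d : R) : 0 < d -> \forall s \near t, rnorm (cis s - cis t) < d.
Proof.
move=> d0; have d20 : 0 < d / 2 by rewrite divr_gt0.
have /cvgrPdist_lt/(_ _ d20) := @continuous_cos R t.
have /cvgrPdist_lt/(_ _ d20) := @continuous_sin R t.
apply: filterS2 => s hs hc.
rewrite (le_lt_trans (rnorm_le_ReIm _))//= (splitr d) ltrD//.
  by rewrite distrC.
by rewrite distrC.
Qed.

Definition cmean f : R := (2 * pi)^-1 * \int[mu]_(t in `[0, 2 * pi]) f (cis t).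

Definition circ_int f := mu.-integrable `[0, 2 * pi] (EFin \o (f \o cis)).

Let pi2 : 0 < 2 * pi :> R. Proof. by rewrite mulr_gt0// pi_gt0. Qed.

Lemma cmean_le f g : circ_int f -> circ_int g ->
  (forall l, rnorm l = 1 -> f l <= g l) -> cmean f <= cmean g.
Proof.
move=> fi gi fg; rewrite ler_wpM2l ?invr_ge0 ?(ltW pi2)// le_Rintegral//.
by move=> t _; apply: fg; rewrite rnorm_cis.
Qed.

Lemma circ_intZ f (s : R) : circ_int f -> circ_int (fun l => s * f l).
Proof.
move=> fi.
by apply: eq_integrable (integrableZl _ s fi) => //.
Qed.

Lemma circ_intD f g : circ_int f -> circ_int g -> circ_int (f \+ g).
Proof.
move=> fi gi.
by apply: eq_integrable (integrableD _ fi gi) => //.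
Qed.

Lemma cmeanZ f (s : R) : circ_int f -> cmean (fun l => s * f l) = s * cmean f.
Proof. by move=> fi; rewrite /cmean RintegralZl// mulrCA. Qed.

Lemma cmeanD f g : circ_int f -> circ_int g ->
  cmean (f \+ g) = cmean f + cmean g.
Proof. by move=> fi gi; rewrite /cmean RintegralD// mulrDr. Qed.

Let mu02pi : mu `[0, 2 * pi] = (2 * pi)%:E.
Proof. by rewrite lebesgue_measure_itv/= lte_fin pi2 sube0. Qed.

Lemma cmean_cst (c : R) : cmean (fun=> c) = c.
Proof.
rewrite /cmean Rintegral_cst// [X in fine X](_ : _ = (2 * pi)%:E) ?mu02pi//.
by rewrite /= mulrCA mulVf ?mulr1// gt_eqF.
Qed.

Definition usc_at {W : normedModType R[i]} (G : set W) (g : W -> R) z :=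
  forall e : R, 0 < e -> exists2 d : R, 0 < d &
    forall w, G w -> rnorm (w - z) < d -> g w < g z + e.

(** Measurability comes from lower semicontinuity of [- f] along the circle; the bound [M] then
    gives integrability on an interval of finite length. *)
Lemma circ_int_usc f (M : R) : (forall l, rnorm l = 1 -> `|f l| <= M) ->
  (forall l, rnorm l = 1 -> usc_at [set l | rnorm l = 1] f l) -> circ_int f.
Proof.
move=> fM fu; apply: measurable_bounded_integrable => //.
- by rewrite [X in (X < _)%E](_ : _ = (2 * pi)%:E) ?mu02pi// ltry.
- apply: measurable_funTS.
  rewrite (_ : f \o cis = \- (\- (f \o cis))); last first.
    by apply/funext => t /=; rewrite opprK.
  apply: measurable_funN; apply/measurable_EFinP.
  apply: lower_semicontinuous_measurable => t a /=; rewrite lte_fin => af.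
  have e0 : 0 < - f (cis t) - a by rewrite subr_gt0.
  have [d d0 fd] := fu _ (rnorm_cis t) _ e0.
  exists [set s | rnorm (cis s - cis t) < d]; first exact: cis_near.
  move=> s /= /(fd _ (rnorm_cis s)); rewrite lte_fin; lra.
- exists M; split; first exact: num_real.
  by move=> y My t _ /=; rewrite (le_trans (fM _ (rnorm_cis t)))// ltW.
Qed.

Lemma circ_int_cst (c : R) : circ_int (fun=> c).
Proof.
apply: (@circ_int_usc _ `|c|) => // l _ e e0.
by exists 1 => // w _ _; rewrite ltrDl.
Qed.

Lemma circ_int_line (W : normedModType R[i]) (G : set W) (g : W -> R) (M : R) a b :
  (forall z, G z -> `|g z| <= M) -> (forall z, G z -> usc_at G g z) ->
  (forall l : R[i], rnorm l = 1 -> G (a + l *: b)) ->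
  circ_int (fun l => g (a + l *: b)).
Proof.
move=> gM ug Gab; apply: (@circ_int_usc _ M) => l l1; first exact/gM/Gab.
move=> e e0; have [d d0 gd] := ug _ (Gab _ l1) _ e0.
have b0 : 0 < rnorm b + 1 by rewrite ltr_wpDl// rnorm_ge0.
exists (d / (rnorm b + 1)); first by rewrite divr_gt0.
move=> w w1 wl; apply: gd; first exact: Gab.
rewrite opprD addrACA subrr add0r -scalerBl rnormZ.
move: wl; rewrite ltr_pdivlMr//; apply: le_lt_trans.
by rewrite ler_wpM2l ?rnorm_ge0// lerDl.
Qed.

(** The mean value property for harmonic polynomials of degree two, which is the order of the Taylor
    expansion of the barrier. [F] is an explicit periodic antiderivative. *)
Lemma cmean_trig (p q : R[i]) :
  circ_int (fun l => complex.Re (p * l + q * l ^+ 2)) /\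
  cmean (fun l => complex.Re (p * l + q * l ^+ 2)) = 0.
Proof.
set f : R[i] -> R := fun l => _.
pose F (t : R) := complex.Re p * sin t + complex.Im p * cos t +
  (complex.Re q * (sin t * cos t) - complex.Im q * (sin t * sin t)).
have dF (t : R) : is_derive t (1 : R) F (f (cis t)).
  rewrite /F; apply: is_derive_eq.
  rewrite /f /cis; case: (p) => p1 p2; case: (q) => q1 q2 /=.
  by rewrite /GRing.scale/=; ring.
have cf : {within `[0, 2 * pi], continuous (f \o cis)}.
  apply: continuous_subspaceT => t.
  apply: differentiable_continuous; apply/derivable1_diffP.
  rewrite (_ : f \o cis = fun t => complex.Re p * cos t - complex.Im p * sin t +
    (complex.Re q * (cos t * cos t - sin t * sin t)
     - complex.Im q * (2 * (sin t * cos t)))).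
    by apply: ex_derive.
  apply/funext => s; rewrite /f /cis/=; case: (p) => p1 p2; case: (q) => q1 q2 /=.
  by ring.
have ci : circ_int f.
  by apply: continuous_compact_integrable => //; exact: segment_compact.
split => //; rewrite /cmean /Rintegral.
rewrite (@continuous_FTC2 _ _ F)//.
- by rewrite /F mulr_natl cos2pi sin2pi cos0 sin0 /= subrr mulr0.
- split.
  + by move=> t _; exact: ex_derive.
  + apply: cvg_at_right_filter; apply: differentiable_continuous.
    by apply/derivable1_diffP; exact: ex_derive.
  + apply: cvg_at_left_filter; apply: differentiable_continuous.
    by apply/derivable1_diffP; exact: ex_derive.
- by move=> t _; rewrite derive1E; exact: derive_val.
Qed.

End circle_means.

(** * Non-thinness of segments *)

Lemma usc_attains_max {R : realType} (X : topologicalType) (K : set X)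
    (f : X -> R) : compact K -> K !=set0 ->
  (forall x, K x -> forall e, 0 < e -> \forall y \near x, K y -> f y < f x + e) ->
  exists2 x, K x & forall y, K y -> f y <= f x.
Proof.
move=> cK [x0 Kx0] uf.
(* Superlevel sets are nested, hence a filter base on [K]; semicontinuity makes every cluster point
   a maximizer. *)
pose up x := [set y | K y /\ f x <= f y].
have FF : ProperFilter (filter_from K up).
  apply: filter_from_proper; last by move=> x Kx; exists x; split.
  apply: filter_from_filter; first by exists x0.
  move=> x y Kx Ky; have [xy|/ltW yx] := leP (f x) (f y).
    by exists y => // z [Kz yz]; split; split => //; exact: le_trans yz.
  by exists x => // z [Kz xz]; split; split => //; exact: le_trans xz.
have [|x [Kx clx]] := cK _ FF; first by exists x0 => // y [].
exists x => // y Ky; apply/ler_addgt0Pr => e e0.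
have [z [[Kz yz] /(_ Kz) /ltW zx]] := clx (up y) _ (ex_intro2 _ _ y Ky (fun _ => id)) (uf x Kx e e0).
exact: le_trans zx.
Qed.

(** * Bounded plurisubharmonic functions and a barrier on the slit disc *)

Section bounded_psh.
Context {R : realType}.

(** With values in [-1, 0] the circle means are real integrals. The radius of a disc is absorbed in
    [b], and a general [W] covers both functions on ['cV[R[i]]_n] and their restrictions to complex
    lines. *)
Definition bpsh {W : normedModType R[i]} (G : set W) (g : W -> R) :=
  [/\ forall z, G z -> -1 <= g z <= 0,
      forall z, G z -> usc_at G g z &
      forall a b, (forall l : R[i], rnorm l <= 1 -> G (a + l *: b)) ->
        g a <= cmean (fun l => g (a + l *: b))].

Lemma bpsh_circ_int (W : normedModType R[i]) (G : set W) g a b : bpsh G g ->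
  (forall l : R[i], rnorm l = 1 -> G (a + l *: b)) ->
  circ_int (fun l => g (a + l *: b)).
Proof.
move=> [g01 ug _]; apply: (@circ_int_line _ _ G _ 1) => // z /g01 /andP[? ?].
by rewrite ler_norml; lra.
Qed.

Lemma rnorm_continuous (W : normedModType R[i]) (f : W -> R) :
  (forall x e, 0 < e -> exists2 d : R, 0 < d &
     forall y, rnorm (y - x) < d -> `|f x - f y| < e) -> continuous f.
Proof.
move=> fc x; apply/cvgrPdist_lt => e /(fc x)[d d0 h].
by apply/nbhs_rnormP; exists d.
Qed.

Lemma lipschitz_continuous (W : normedModType R[i]) (C : R) (f : W -> R) :
  (forall x y, f y <= f x + C * rnorm (y - x)) -> continuous f.
Proof.
move=> fC; apply: rnorm_continuous => x e e0.
exists (e / (`|C| + 1)) => [|y]; first by rewrite divr_gt0// ltr_wpDl.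
rewrite ltr_pdivlMr ?ltr_wpDl// => yx.
have := fC x y; have := fC y x; rewrite [rnorm (x - y)]rnormB => h1 h2.
have h3 : C * rnorm (y - x) <= rnorm (y - x) * (`|C| + 1).
  by rewrite mulrC ler_wpM2l ?rnorm_ge0// (le_trans (ler_norm _))// lerDl.
by rewrite ltr_norml; apply/andP; split; lra.
Qed.

Lemma continuous_rnorm (W : normedModType R[i]) :
  continuous (rnorm : W -> R).
Proof.
apply: (@lipschitz_continuous _ 1) => x y.
by have := rnormD x (y - x); rewrite addrC subrK mul1r.
Qed.

Lemma continuous_Re : continuous (@complex.Re R).
Proof.
apply: (@lipschitz_continuous _ 1) => x y; rewrite mul1r -lerBlDl.
apply: le_trans (le_trans (ler_norm _) (Re_le_rnorm _)).
by case: x => a b; case: y => c d.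
Qed.

Lemma compact_disc (d : R) : compact [set k : R[i] | rnorm k <= d].
Proof.
pose F (p : R * R) : R[i] := p.1 +i* p.2.
have cF : continuous F.
  move=> [x1 x2]; apply/cvg_ballP => e e0.
  have /nbhs_rnormP[d1 d10 hd] : nbhs (F (x1, x2)) (ball (F (x1, x2)) e).
    exact: nbhsx_ballx.
  have d20 : 0 < d1 / 2 by rewrite divr_gt0.
  exists (ball x1 (d1 / 2), ball x2 (d1 / 2)).
    by split; exact: nbhsx_ballx.
  move=> [y1 y2] [/= h1 h2]; apply: hd.
  rewrite (le_lt_trans (rnorm_le_ReIm _))//= (splitr d1) ltrD//.
    by rewrite distrC.
  by rewrite distrC.
apply: (@subclosed_compact _ _ (F @` (`[- d, d] `*` `[- d, d]))).
- have -> : [set k : R[i] | rnorm k <= d] = rnorm @^-1` [set x | x <= d] by [].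
  apply: preimage_closed; last exact: closed_le.
  by move=> ? _; exact: continuous_rnorm.
- apply: continuous_compact; first exact: continuous_subspaceT.
  by apply: compact_setX; exact: segment_compact.
- move=> k kd; exists (complex.Re k, complex.Im k); last by case: k kd.
  split; rewrite /= in_itv/= -ler_norml.
    exact: le_trans (Re_le_rnorm _) kd.
  exact: le_trans (Im_le_rnorm _) kd.
Qed.

(* The imaginary part of the square root of [k] in the upper half plane. *)
Definition Im_sqrt (k : R[i]) : R := Num.sqrt ((rnorm k - complex.Re k) / 2).

Lemma Im_sqrt_sqr k : Im_sqrt k ^+ 2 = (rnorm k - complex.Re k) / 2.
Proof.
rewrite sqr_sqrtr// divr_ge0// subr_ge0.
exact: le_trans (ler_norm _) (Re_le_rnorm _).
Qed.

Lemma Im_sqrtP k : exists2 w : R[i], w ^+ 2 = k & complex.Im w = Im_sqrt k.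
Proof.
have key (w : R[i]) : w ^+ 2 = k -> `|complex.Im w| = Im_sqrt k.
  move=> wk; rewrite /Im_sqrt -wk rnormX rnormC_sqr -[LHS]sqrtr_sqr; congr Num.sqrt.
  by case: w {wk} => a b /=; field.
have [Im0|/ltW Im0] := leP 0 (complex.Im (sqrtc k)).
  exists (sqrtc k); first exact: sqr_sqrtc.
  by rewrite -(key _ (sqr_sqrtc k)) ger0_norm.
exists (- sqrtc k); first by rewrite sqrrN sqr_sqrtc.
rewrite -(key (- sqrtc k)) ?sqrrN ?sqr_sqrtc// ger0_norm//.
by case: (sqrtc k) Im0 => a b /=; rewrite oppr_ge0.
Qed.

Lemma continuous_Im_sqrt : continuous Im_sqrt.
Proof.
move=> k; apply: (@continuous_comp _ _ _ (fun k : R[i] => (rnorm k - complex.Re k) / 2) Num.sqrt).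
  apply: (@lipschitz_continuous _ 1) => x y.
  have := rnormD x (y - x); rewrite addrC subrK => xy.
  have : complex.Re x - complex.Re y <= rnorm (y - x).
    rewrite rnormB; apply: le_trans (le_trans (ler_norm _) (Re_le_rnorm _)).
    by case: (x) => a b; case: (y).
  by rewrite mul1r; lra.
exact: sqrt_continuous.
Qed.

(** No branch of the root is differentiated. If [w0 + T] is the Taylor polynomial and [w] the root
    of [k0 + h] in the closed upper half plane, then [(w0 + T - w) * (w0 + T + w)] is of order three
    in [h], and the second factor stays away from 0 because its imaginary part does. *)
Lemma Im_sqrt_taylor (k0 : R[i]) : 0 < Im_sqrt k0 ->
  exists (r0 C : R) (p q : R[i]), [/\ 0 < r0, 0 <= C & forall h, rnorm h <= r0 ->
    Im_sqrt (k0 + h) <= Im_sqrt k0 + complex.Re (p * h + q * h ^+ 2)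
      + C * rnorm h ^+ 3].
Proof.
move=> b0; have [w0 wk0 Iw0] := Im_sqrtP k0.
have w00 : w0 != 0.
  by apply: contraTneq b0 => w0E; rewrite -Iw0 w0E /= ltxx.
pose c : R := rnorm (2 * w0)^-1 + rnorm (8 * w0 ^+ 3)^-1.
have c0 : 0 <= c by rewrite addr_ge0// rnorm_ge0.
pose C1 : R := rnorm (8 * w0 ^+ 4)^-1 + rnorm (64 * w0 ^+ 6)^-1.
have C10 : 0 <= C1 by rewrite addr_ge0// rnorm_ge0.
pose b := Im_sqrt k0.
(* The factors [- 'i] and ['i] turn the imaginary part of [T] into a real part. The radius gives
   [|Im T| <= b / 2], hence [b / 2 <= |w0 + T + w|]; the bound 1 absorbs higher powers of [|h|]. *)
exists (Num.min 1 (b / (2 * (c + 1)))), (2 * C1 / b), (- 'i%C * (2 * w0)^-1),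
  ('i%C * (8 * w0 ^+ 3)^-1).
have c20 : 0 < 2 * (c + 1) by rewrite mulr_gt0// ltr_wpDl.
split.
- by rewrite lt_min ltr01 divr_gt0.
- by rewrite divr_ge0// ?mulr_ge0// ltW.
move=> h; rewrite le_min ler_pdivlMr// => /andP[h1 hb].
have h0 := rnorm_ge0 h.
have [w wk Iw] := Im_sqrtP (k0 + h).
pose T : R[i] := h * (2 * w0)^-1 - h ^+ 2 * (8 * w0 ^+ 3)^-1.
have TI : complex.Im T = complex.Re (- 'i%C * (2 * w0)^-1 * h + 'i%C * (8 * w0 ^+ 3)^-1 * h ^+ 2).
  rewrite /T; case: (h) (2 * w0)^-1 (8 * w0 ^+ 3)^-1 => [h1' h2'] [a1 a2] [b1 b2] /=.
  by ring.
rewrite -TI -/b.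
have Tc : rnorm T <= rnorm h * c.
  rewrite (le_trans (rnormD _ _))// rnormN (rnormM h) (rnormM (h ^+ 2)) mulrDr lerD//.
  rewrite ler_wpM2r ?rnorm_ge0// rnormX expr2 ler_piMl//.
have ImT : b / 2 <= b + complex.Im T.
  have := Im_le_rnorm T; rewrite ler_norml => /andP[+ _].
  nra.
have b0' : 0 < b by [].
pose E : R[i] := h ^+ 4 * (64 * w0 ^+ 6)^-1 - h ^+ 3 * (8 * w0 ^+ 4)^-1.
have EE : (w0 + T - w) * (w0 + T + w) = E.
  rewrite -subr_sqr wk -wk0 /E /T; field.
  exact: w00.
have E3 : rnorm E <= C1 * rnorm h ^+ 3.
  rewrite (le_trans (rnormD _ _))// rnormN (rnormM (h ^+ 4)) (rnormM (h ^+ 3)) !rnormX /C1.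
  have h43 : rnorm h ^+ 4 <= rnorm h ^+ 3 by rewrite [leLHS]exprS ler_piMl// exprn_ge0.
  have := rnorm_ge0 (64 * w0 ^+ 6)^-1; have := rnorm_ge0 (8 * w0 ^+ 4)^-1.
  move: (rnorm (64 * w0 ^+ 6)^-1) (rnorm (8 * w0 ^+ 4)^-1) => A B B0 A0.
  by rewrite [leLHS]addrC [leRHS]mulrDl lerD// mulrC// ler_wpM2l.
have bw : b / 2 <= rnorm (w0 + T + w).
  apply: le_trans (le_trans (ler_norm _) (Im_le_rnorm _)).
  have -> : complex.Im (w0 + T + w) = b + complex.Im T + complex.Im w.
    by rewrite /b -Iw0; case: (w0) => ? ?; case: (T) => ? ?; case: (w).
  by rewrite (le_trans ImT)// lerDl Iw sqrtr_ge0.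
have : rnorm (w0 + T - w) * (b / 2) <= C1 * rnorm h ^+ 3.
  apply: le_trans E3; rewrite -EE rnormM ler_wpM2l ?rnorm_ge0//.
have : complex.Im w - (b + complex.Im T) <= rnorm (w0 + T - w).
  rewrite rnormB; apply: le_trans (le_trans (ler_norm _) (Im_le_rnorm _)).
  by rewrite /b -Iw0; case: (w0) => ? ?; case: (T) => ? ?; case: (w) => /= *; lra.
rewrite Iw => wT Cb; rewrite -lerBlDl; apply: le_trans wT _.
have -> : 2 * C1 / b * rnorm h ^+ 3 = (C1 * rnorm h ^+ 3) / (b / 2).
  by field; rewrite ?gt_eqF.
by rewrite ler_pdivlMr// divr_gt0.
Qed.


(* Off the slit of nonnegative reals, [Re] and [Im_sqrt] are harmonic while
   [- rnorm ^+ 2] is strictly superharmonic. *)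
Definition slit_barrier (d : R) (k : R[i]) : R :=
  complex.Re k - rnorm k ^+ 2 / (2 * d) + 2 * Num.sqrt d * Im_sqrt k.

(** On the disc [Im_sqrt k] is at most [sqrt d], so [|k| - Re k = 2 (Im_sqrt k)^2 <= 2 sqrt d *
    Im_sqrt k]: the first and last terms of the barrier dominate [|k|], and the quadratic term takes
    away at most [|k| / 2]. *)
Lemma slit_barrier_ge (d : R) k : 0 < d -> rnorm k <= d ->
  rnorm k / 2 <= slit_barrier d k.
Proof.
move=> d0 kd; have k0 := rnorm_ge0 k.
have b0 : 0 <= Im_sqrt k by exact: sqrtr_ge0.
have bd : Im_sqrt k <= Num.sqrt d.
  rewrite ler_wsqrtr// ler_pdivrMr//.
  have := Re_le_rnorm k; rewrite ler_norml; lra.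
have kk : rnorm k ^+ 2 / (2 * d) <= rnorm k / 2.
  by rewrite ler_pdivrMr ?mulr_gt0//; nra.
have := Im_sqrt_sqr k; rewrite /slit_barrier; nra.
Qed.

Lemma continuous_slit_barrier (d : R) : continuous (slit_barrier d).
Proof.
move=> k; have Fk : ProperFilter (nbhs k) := nbhs_pfilter k.
apply: cvgD; first apply: cvgB.
- exact: continuous_Re.
- apply: cvgM; last exact: cvg_cst.
  have c := @continuous_rnorm R[i] k.
  by rewrite [X in _ --> X]expr2; under eq_fun do rewrite expr2; apply: cvgM; exact: c.
- by apply: cvgM; [exact: cvg_cst|exact: continuous_Im_sqrt].
Qed.

(** On a circle of radius [r] the quadratic term lowers the mean by [r^2 / (2 d)], which beats the
    cubic Taylor error [D r^3] once [r <= 1 / (4 d (D + 1))]. The majorant [phi] is a trigonometric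
    polynomial, so its mean is known exactly. *)
Lemma slit_barrier_cmean (d : R) (k0 : R[i]) : 0 < d -> 0 < Im_sqrt k0 ->
  exists2 r0 : R, 0 < r0 & forall r : R, 0 < r <= r0 ->
    exists phi : R[i] -> R, [/\ circ_int phi, cmean phi < slit_barrier d k0 &
      forall l : R[i], rnorm l = 1 -> slit_barrier d (k0 + r%:C * l) <= phi l].
Proof.
move=> d0 /Im_sqrt_taylor[r1 [C [p [q [r10 C0 bC]]]]].
pose S := Num.sqrt d; have S0 : 0 <= S by exact: sqrtr_ge0.
pose D := 2 * S * C; have D0 : 0 <= D by rewrite !mulr_ge0.
exists (Num.min r1 (1 / (4 * d * (D + 1)))).
  by rewrite lt_min r10 divr_gt0// !mulr_gt0// ltr_wpDl.
move=> r /andP[r0]; rewrite le_min => /andP[rr1].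
rewrite ler_pdivlMr; last by rewrite !mulr_gt0// ltr_wpDl.
move=> rD.
pose P : R[i] := r%:C * (1 - k0^*%C / d%:C + (2 * S)%:C * p).
pose Q : R[i] := ((2 * S)%:C * (r%:C ^+ 2 * q)).
pose c := slit_barrier d k0 - r ^+ 2 / (2 * d) + D * r ^+ 3.
have [PQi PQ0] := cmean_trig P Q.
exists (fun l => c + complex.Re (P * l + Q * l ^+ 2)); split.
- by apply: circ_intD => //; exact: circ_int_cst.
- rewrite (@cmeanD _ (fun=> c) (fun l => complex.Re (P * l + Q * l ^+ 2)))//;
    last exact: circ_int_cst.
  rewrite cmean_cst PQ0 addr0 /c -addrA gtrDl addrC subr_lt0.
  rewrite ltr_pdivlMr ?mulr_gt0//.
  have : r ^+ 2 * (r * (4 * d * (D + 1))) <= r ^+ 2 * 1.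
    by rewrite ler_wpM2l// sqr_ge0.
  have : 0 < r ^+ 2 by rewrite exprn_gt0.
  have : 0 <= d * r ^+ 3 by rewrite mulr_ge0 ?exprn_ge0 ?(ltW d0) ?(ltW r0).
  have : 0 <= d * r ^+ 3 * D by rewrite !mulr_ge0 ?exprn_ge0 ?(ltW d0) ?(ltW r0).
  rewrite exprS; move: (r ^+ 2) => r2; nra.
- move=> l l1.
  have hr : rnorm (r%:C * l) = r by rewrite rnormM l1 mulr1 rnorm_real gtr0_norm.
  have := bC (r%:C * l); rewrite hr => /(_ rr1) hb.
  have hn : rnorm (k0 + r%:C * l) ^+ 2 =
      rnorm k0 ^+ 2 + r ^+ 2 + 2 * r * complex.Re (k0^*%C * l).
    have := rnormC_sqr l; rewrite l1 expr1n !rnormC_sqr.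
    case: (k0) => x y; case: (l) => u v /= uv.
    have -> : r ^+ 2 = r ^+ 2 * (u ^+ 2 + v ^+ 2) by rewrite -uv mulr1.
    by ring.
  rewrite /slit_barrier hn /c /slit_barrier -/S.
  have hb2 : 2 * S * Im_sqrt (k0 + r%:C * l) <= 2 * S * Im_sqrt k0
    + 2 * S * complex.Re (p * (r%:C * l) + q * (r%:C * l) ^+ 2) + D * r ^+ 3.
    rewrite /D -(mulrA (2 * S) C) -!mulrDr ler_wpM2l// mulr_ge0//.
  have -> : complex.Re (P * l + Q * l ^+ 2) = r * complex.Re l
     - r * complex.Re (k0^*%C * l) / d +
    2 * S * complex.Re (p * (r%:C * l) + q * (r%:C * l) ^+ 2).
    rewrite /P /Q; have -> : k0^*%C / d%:C = k0^*%C * (d^-1)%:C.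
      by rewrite fmorphV.
    by case: (k0) => x y; case: (l) => u v; case: (p) => p1 p2; case: (q) => q1 q2 /=; ring.
  have -> : complex.Re (k0 + r%:C * l) = complex.Re k0 + r * complex.Re l.
    by case: (k0) => x y; case: (l) => u v /=; ring.
  have -> : (rnorm k0 ^+ 2 + r ^+ 2 + 2 * r * complex.Re (k0^*%C * l)) / (2 * d)
    = rnorm k0 ^+ 2 / (2 * d) + r ^+ 2 / (2 * d) + r * complex.Re (k0^*%C * l) / d.
    by field; rewrite gt_eqF.
  lra.
Qed.

(* The maximum principle on a disc slit along the segment from [eta] on, with
   the majorant [slit_barrier]; then [eta] tends to [0]. *)
Lemma segment_nonthin (G : set R[i]) (v : R[i] -> R) (s c : R) : bpsh G v ->
  0 < s -> (forall l, rnorm l <= s -> G l) ->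
  (forall t : R, 0 < t <= s -> v t%:C <= c) -> v 0 <= c.
Proof.
move=> pv s0 Gs vc; rewrite leNgt; apply/negP => cv.
have [v01 uv mv] := pv.
have [v0 v1] : v 0 <= 0 /\ forall l, rnorm l <= s -> v l <= 0.
  have h0 : rnorm (0 : R[i]) <= s by rewrite rnorm0 ltW.
  split; first by have /andP[] := v01 0 (Gs 0 h0).
  by move=> l ls; have /andP[] := v01 l (Gs l ls).
pose d := s / 2; have d0 : 0 < d by rewrite divr_gt0.
(* This [K] makes [f <= c] on the outer circle, where [v <= 0] and the barrier is at least
   [d / 2]. *)
have [K K0 Kd] : exists2 K : R, 0 < K & K * (d / 2) = - c.
  exists (2 * (- c) / d); last by field; rewrite gt_eqF.
  by rewrite divr_gt0// mulr_gt0//; lra.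
(* One small [eta] replaces the limit. The origin is the point [k = - eta] of the disc around [eta];
   since [Im_sqrt (- eta) = sqrt d * tau], the barrier there is at most [2 d tau], and
   [K * 2 d tau <= (v 0 - c) / 2] leaves [f (- eta) > c]. *)
pose tau := Num.min 1 ((v 0 - c) / (4 * K * d)).
have tau0 : 0 < tau.
  by rewrite lt_min ltr01 divr_gt0 ?subr_gt0// !mulr_gt0.
have tau1 : tau <= 1 by rewrite ge_min lexx.
have tauK : tau * (4 * K * d) <= v 0 - c.
  by rewrite -ler_pdivlMr ?mulr_gt0// ge_min lexx orbT.
pose eta := d * tau ^+ 2.
have eta0 : 0 < eta by rewrite mulr_gt0// exprn_gt0.
have etad : eta <= d by rewrite ler_piMr ?exprn_ile1// ltW.
have Geta k : rnorm k <= d -> rnorm (eta%:C + k) <= s.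
  move=> kd; rewrite (le_trans (rnormD _ _))// rnorm_real gtr0_norm//.
  by rewrite /d in kd etad; lra.
pose g := slit_barrier d.
pose f k := v (eta%:C + k) - K * g k.
have [||k0 /= k0d fmax] := @usc_attains_max _ _ _ f (@compact_disc d).
- by exists 0; rewrite /= rnorm0 ltW.
- move=> k /= kd e e0; have e20 : 0 < e / 2 by rewrite divr_gt0.
  have [d1 d10 hd] := uv _ (Gs _ (Geta _ kd)) _ e20.
  have eK : 0 < e / 2 / K by rewrite divr_gt0.
  have /cvgrPdist_lt/(_ _ eK) := @continuous_slit_barrier d k.
  have : \forall y \near k, rnorm (y - k) < d1 by apply/nbhs_rnormP; exists d1.
  apply: filterS2 => y yk gy yd.
  have := hd _ (Gs _ (Geta _ yd)); rewrite opprD addrACA subrr add0r => /(_ yk) vy.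
  move: gy; rewrite ltr_norml => /andP[_]; rewrite ltrBlDr => gy.
  have KK : K * (e / 2 / K) = e / 2 by field; rewrite gt_eqF.
  move: gy; rewrite -(ltr_pM2l K0) (mulrDr K (e / 2 / K)) KK /f /g => gy; lra.
have fk0 : c < f k0.
  have /fmax : rnorm (- eta%:C) <= d by rewrite rnormN rnorm_real gtr0_norm.
  apply: lt_le_trans; rewrite /f subrr /g /slit_barrier.
  have -> : Im_sqrt (- eta%:C) = Num.sqrt d * tau.
    rewrite /Im_sqrt rnormN rnorm_real gtr0_norm//=.
    have -> : (eta - - eta) / 2 = d * tau ^+ 2 by rewrite -/eta; field.
    by rewrite sqrtrM ?(ltW d0)// sqrtr_sqr gtr0_norm.
  have -> : 2 * Num.sqrt d * (Num.sqrt d * tau) = 2 * d * tau.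
    by have := sqr_sqrtr (ltW d0); move: (Num.sqrt d) => S <-; ring.
  have : 0 <= K * (rnorm (- eta%:C) ^+ 2 / (2 * d)).
    by rewrite mulr_ge0 ?(ltW K0)// divr_ge0 ?sqr_ge0// mulr_ge0// ltW.
  have : 0 <= K * eta by rewrite mulr_ge0// ltW.
  rewrite /=; nra.
have gk0 := slit_barrier_ge d0 k0d; have k00 := rnorm_ge0 k0.
have k0d' : rnorm k0 < d.
  rewrite lt_neqAle k0d andbT; apply/eqP => k0E.
  move: fk0; rewrite /f /g; rewrite k0E in gk0.
  have := v1 _ (Geta _ k0d); have := ler_wpM2l (ltW K0) gk0; lra.
(* [Im_sqrt] vanishes only on the slit, where [v <= c] and the barrier is nonnegative, against
   [c < f k0]. *)
have b0 : 0 < Im_sqrt k0.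
  rewrite lt_def sqrtr_ge0 andbT; apply/eqP => b0.
  have := Im_sqrt_sqr k0; rewrite b0 expr0n /= => /esym/eqP.
  rewrite mulf_eq0 invr_eq0 [2 == 0]pnatr_eq0 orbF subr_eq0 => /eqP k0E.
  have k0R : k0 = (rnorm k0)%:C.
    have := rnormC_sqr k0; rewrite k0E -[X in X = _]addr0 => /addrI/esym/eqP.
    by rewrite sqrf_eq0; case: (k0) => x y /= /eqP ->.
  move: fk0; rewrite /f /g.
  have := vc (eta + rnorm k0); rewrite rmorphD/= -k0R.
  have := Geta _ k0d; rewrite {1}k0R -rmorphD/= rnorm_real ger0_norm; last lra.
  move=> -> /(_ _); rewrite andbT => /(_ _).
  have : 0 <= K * slit_barrier d k0 by rewrite mulr_ge0 ?(ltW K0)//; lra.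
  lra.
(* The maximum is interior and off the slit; there the submean inequality for [v] contradicts the
   strict one for the barrier. *)
have [r0 r00 hr] := slit_barrier_cmean d0 b0.
pose r := Num.min r0 (d - rnorm k0).
have r_gt0 : 0 < r by rewrite lt_min r00 subr_gt0.
have rd : r <= d - rnorm k0 by rewrite ge_min lexx orbT.
have [|phi [phi_i phi_lt phi_ge]] := hr r; first by rewrite r_gt0 ge_min lexx.
have kr (l : R[i]) : rnorm l <= 1 -> rnorm (k0 + r%:C * l) <= d.
  move=> l1; rewrite (le_trans (rnormD _ _))// rnormM rnorm_real gtr0_norm//.
  nra.
have lZ (l : R[i]) : eta%:C + k0 + l *: (r%:C : R[i]) = eta%:C + (k0 + r%:C * l).
  by rewrite -addrA; congr (_ + (_ + _)); rewrite mulrC.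
have Gl (l : R[i]) : rnorm l <= 1 -> G (eta%:C + k0 + l *: (r%:C : R[i])).
  by move=> l1; rewrite lZ; apply/Gs/Geta/kr.
have := mv _ _ Gl; apply/negP; rewrite -ltNge.
have fi := circ_int_cst (f k0).
apply: (@le_lt_trans _ _ (cmean (fun l => f k0 + K * phi l))).
  apply: cmean_le.
  - by apply: bpsh_circ_int pv _ => l l1; apply: Gl; rewrite l1.
  - by apply: circ_intD => //; exact: circ_intZ.
  - move=> l l1; have l1' : rnorm l <= 1 by rewrite l1.
    have := fmax _ (kr _ l1'); rewrite lZ {1}/f.
    have := ler_wpM2l (ltW K0) (phi_ge _ l1); rewrite /g; lra.
rewrite (@cmeanD _ (fun=> f k0) (fun l => K * phi l))//; last exact: circ_intZ.
rewrite cmean_cst cmeanZ// /f /g addrAC -addrA gtrDl -mulrBr.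
by rewrite pmulr_rlt0// subr_lt0.
Qed.

End bounded_psh.

(** * Simons' inequality *)

Section convex_sup.
Context {R : realType} {X : topologicalType}.
Variable A : set X.
Implicit Types f g : X -> R.

Definition supA f : R := sup (f @` A).

Definition bndA f := exists M : R, forall x, A x -> f x <= M.

Lemma supA_ub f x : bndA f -> A x -> f x <= supA f.
Proof.
move=> [M fM] Ax; apply: ub_le_sup; last by exists x.
by exists M => _ [y Ay <-]; exact: fM.
Qed.

Lemma supA_le f (M : R) : A !=set0 -> (forall x, A x -> f x <= M) -> supA f <= M.
Proof.
move=> [x Ax] fM; apply: ge_sup; first by exists (f x), x.
by move=> _ [y Ay <-]; exact: fM.
Qed.

Definition usc_on_set f :=
  forall x, A x -> forall e, 0 < e -> \forall y \near x, A y -> f y < f x + e.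

Local Notation q k := ((2^-1 : R) ^+ k).

Lemma half_pow_gt0 k : 0 < q k.
Proof. by rewrite exprn_gt0// invr_gt0. Qed.

Lemma half_powS k : q k.+1 = q k / 2.
Proof. by rewrite exprSr. Qed.

Lemma half_pow_small (e : R) : 0 < e -> exists k, q k < e.
Proof.
move=> e0; have h1 : `|2^-1 : R| < 1 by rewrite ger0_norm ?invr_ge0// invf_lt1 ?ltr1n.
have /cvgrPdist_lt/(_ _ e0)[k _ hk] := cvg_expr h1.
exists k; have := hk k (leqnn k).
by rewrite /= sub0r normrN ger0_norm// ltW// half_pow_gt0.
Qed.

Lemma le_half_powP (a b : R) : (forall k, a <= b + q k) -> a <= b.
Proof.
move=> ab; apply/ler_addgt0Pr => e /half_pow_small[k /ltW ke].
by rewrite (le_trans (ab k))// lerD2l.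
Qed.

(* Simons' argument: for a series [\sum_j 2^-(j+1) g_j] with [g_j] a
   near-minimizer of [sup_A (S_j + 2^-j g)] over [C j], the tails at a point
   where the sum attains its maximum over [A] are not small. *)
Lemma convex_dini (C : nat -> set (X -> R)) : compact A ->
  (forall k, C k !=set0) -> (forall k, C k.+1 `<=` C k) ->
  (forall g, C 0%N g -> usc_on_set g /\ forall x, A x -> 0 <= g x <= 1) ->
  (forall k f g, C k f -> C k g -> C k (fun x => (f x + g x) / 2)) ->
  (forall x, A x -> forall e, 0 < e -> exists k, forall g, C k g -> g x <= e) ->
  forall e, 0 < e -> exists2 g, C 0%N g & forall x, A x -> g x <= e.
Proof.
move=> cA C0 CS Creg Cmid Csmall e e0; apply: contrapT => noC.
have big g : C 0%N g -> exists2 x, A x & e < g x.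
  move=> Cg; apply: contrapT => h; apply: noC; exists g => // x Ax.
  by rewrite leNgt; apply/negP => gx; apply: h; exists x.
have C0k k : C k `<=` C 0%N.
  by elim: k => // k ih; exact: subset_trans (CS k) ih.
have C01 k g x : C k g -> A x -> 0 <= g x <= 1.
  by move=> /C0k/Creg[_]; exact.
have [a Aa] : A !=set0.
  by have [g Cg] := C0 0%N; have [x Ax _] := big g Cg; exists x.
pose d := e / 4; have d0 : 0 < d by rewrite divr_gt0.
(* The premise on [kS.2] guards a choice made for arbitrary pairs; [S01] discharges it for the
   partial sums. *)
have step (kS : nat * (X -> R)) : exists g, C kS.1 g /\
    ((forall x, A x -> 0 <= kS.2 x <= 1) -> forall g', C kS.1 g' ->
    supA (fun x => kS.2 x + q kS.1 * g x)
      <= supA (fun x => kS.2 x + q kS.1 * g' x) + d * (q kS.1 ^+ 2 / 4)).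
  case: kS => k S /=; have [S01|nS] := pselect (forall x, A x -> 0 <= S x <= 1); last first.
    by have [g Cg] := C0 k; exists g; split.
  have bS g : C k g -> bndA (fun x => S x + q k * g x).
    move=> Cg; exists (1 + q k) => x Ax.
    have /andP[_ ?] := S01 x Ax; have /andP[_ ?] := C01 _ _ _ Cg Ax.
    by rewrite lerD// ler_piMr// ltW// half_pow_gt0.
  pose E := [set supA (fun x => S x + q k * g x) | g in C k].
  have iE : has_inf E.
    split; first by have [g Cg] := C0 k; exists (supA (fun x => S x + q k * g x)), g.
    exists 0 => _ [g Cg <-]; apply: le_trans (supA_ub (bS _ Cg) Aa).
    have /andP[? _] := S01 a Aa; have /andP[? _] := C01 _ _ _ Cg Aa.
    by rewrite addr_ge0// mulr_ge0// ltW// half_pow_gt0.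
  have e1 : 0 < d * (q k ^+ 2 / 4).
    by rewrite mulr_gt0// divr_gt0// exprn_gt0// half_pow_gt0.
  have [_ [g Cg <-] gE] := inf_adherent e1 iE.
  exists g; split => // _ g' Cg'; rewrite (le_trans (ltW gE))// lerD2r.
  by apply: ge_inf; [case: iE|exists g'].
have [pick pickP] := choice step.
pose S := fix S k : X -> R := if k is k'.+1 then
  fun x => S k' x + q k'.+1 * pick (k', S k') x else fun=> 0.
pose gs k := pick (k, S k).
have SS k x : S k.+1 x = S k x + q k.+1 * gs k x by [].
have Cgs k : C k (gs k) by have [] := pickP (k, S k).
have mix n k g : C (k + n)%N g -> exists2 h, C k h &
    forall x, S k x + q k * h x = S (k + n)%N x + q (k + n)%N * g x.
  elim: n k => [|n ih] k; first by rewrite addn0 => Cg; exists g.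
  rewrite addnS -addSn => /ih[h Ch hE].
  exists (fun x => (gs k x + h x) / 2); first by apply: Cmid => //; exact: CS.
  by move=> x; rewrite -hE SS half_powS; field.
have gs01 k x : A x -> 0 <= gs k x <= 1 by move=> Ax; exact: C01 (Cgs k) Ax.
have tail k n x (M : R) : A x -> (forall g, C k g -> g x <= M) ->
    S (k + n)%N x <= S k x + q k * M.
  move=> Ax CM; have [h Ch /(_ x) hE] := mix n k _ (Cgs (k + n)%N).
  have := CM _ Ch; rewrite -(ler_pM2l (half_pow_gt0 k)) -(lerD2l (S k x)) hE.
  apply: le_trans; rewrite lerDl mulr_ge0 ?(ltW (half_pow_gt0 _))//.
  by have /andP[] := gs01 (k + n)%N x Ax.
have Smono k n x : A x -> S k x <= S (k + n)%N x.
  move=> Ax; elim: n => [|n ih]; first by rewrite addn0.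
  rewrite addnS SS (le_trans ih)// lerDl mulr_ge0 ?(ltW (half_pow_gt0 _))//.
  by have /andP[] := gs01 (k + n)%N x Ax.
have Stail k n x : A x -> S n x <= S k x + q k.
  move=> Ax; have [nk|/ltnW kn] := leqP n k.
    rewrite -(subnKC nk); apply: le_trans (Smono n (k - n)%N x Ax) _.
    by rewrite lerDl ltW// half_pow_gt0.
  rewrite -{1}(subnKC kn) -[X in _ + X]mulr1; apply: tail => // g Cg.
  by have /andP[] := C01 _ _ _ Cg Ax.
have S01 k x : A x -> 0 <= S k x <= 1.
  move=> Ax; have /= := Smono 0%N k x Ax; rewrite add0n => -> /=.
  by have /= := Stail 0%N k x Ax; rewrite add0r expr0.
pose T x := sup [set S k x | k in setT].
have TS k x : A x -> S k x <= T x.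
  move=> Ax; apply: ub_le_sup; last by exists k.
  by exists 1 => _ [j _ <-]; have /andP[] := S01 j x Ax.
have ST k x : A x -> T x <= S k x + q k.
  move=> Ax; apply: ge_sup; first by exists (S 0%N x), 0%N.
  by move=> _ [j _ <-]; exact: Stail.
have uS k : usc_on_set (S k).
  elim: k => [|k ih] x Ax r r0; first by near=> y => _; rewrite ltrDl.
  have r20 : 0 < r / 2 by rewrite divr_gt0.
  have [ug _] := Creg _ (C0k _ _ (Cgs k)).
  apply: filterS2 (ih x Ax _ r20) (ug x Ax _ r20) => y h1 h2 Ay.
  rewrite !SS; have := h1 Ay; have := h2 Ay.
  have := half_pow_gt0 k.+1; have : q k.+1 <= 1.
    by rewrite exprn_ile1 ?invr_ge0// invf_le1 ?ler1n.
  move: (q k.+1) => qk; nra.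
have uT : usc_on_set T.
  move=> x Ax r r0; have r20 : 0 < r / 2 by rewrite divr_gt0.
  have [k qk] := half_pow_small r20.
  apply: filterS (uS k x Ax _ r20) => y h Ay.
  have := h Ay; have := ST k y Ay; have := TS k x Ax; lra.
have [x0 Ax0 Tmax] := usc_attains_max cA (ex_intro _ a Aa) uT.
set P := T x0 in Tmax *.
(* By [mix] the later part of the series is itself a competitor for the near-minimum at step [k],
   and its sum is at most [T + q (k + n)]. *)
have PN k : supA (fun x => S k x + q k * gs k x) <= P + d * (q k ^+ 2 / 4).
  apply: le_half_powP => n.
  have [h Ch hE] := mix n k _ (Cgs (k + n)%N).
  have [_ /= /(_ (S01 k) _ Ch) hk] := pickP (k, S k).
  apply: le_trans hk _; rewrite [leRHS]addrAC lerD2r.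
  apply: supA_le; first by exists a.
  move=> x Ax; rewrite hE lerD//; first by rewrite (le_trans (TS _ _ Ax))// Tmax.
  have /andP[_ g1] := gs01 (k + n)%N x Ax.
  rewrite (le_trans (ler_piMr _ g1)) ?(ltW (half_pow_gt0 _))//.
  by rewrite exprD ler_piMl ?(ltW (half_pow_gt0 _))// exprn_ile1 ?invr_ge0// invf_le1 ?ler1n.
(* [S k.+1] is the midpoint of [S k] and [S k + q k * gs k], the latter bounded by [PN]; the
   tolerance [d q^2 / 4] is what lets the error [d q (1 - q)] reproduce itself when [q] is
   halved. *)
have Sup k x : A x -> S k x <= (1 - q k) * P + d * (q k * (1 - q k)).
  move=> Ax; elim: k => [|k ih]; first by rewrite /= expr0; lra.
  have bk : bndA (fun x => S k x + q k * gs k x).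
    exists 2 => y Ay; have /andP[_ ?] := S01 k y Ay; have /andP[_ ?] := gs01 k y Ay.
    have : q k <= 1 by rewrite exprn_ile1 ?invr_ge0// invf_le1 ?ler1n.
    have := half_pow_gt0 k; move: (q k) => qk; nra.
  have := le_trans (supA_ub bk Ax) (PN k).
  rewrite SS half_powS; move: ih (half_pow_gt0 k).
  move: (q k) (S k x) (gs k x) => qk s g ih qk0.
  have : 0 <= d * qk ^+ 2 by rewrite mulr_ge0 ?sqr_ge0// ltW.
  nra.
(* From index 0 the whole partial sum with its remainder is an element of [C 0], which exceeds [e]
   somewhere on [A]. *)
have Pe : e <= P.
  apply: le_half_powP => k; have [h Ch hE] := mix k 0%N _ (Cgs (0 + k)%N).
  have [x Ax] := big h Ch; have := hE x; rewrite /= add0r expr0 mul1r add0n => ->.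
  move=> /ltW/le_trans; apply; rewrite lerD//.
    by rewrite (le_trans (TS _ _ Ax))// Tmax.
  have /andP[_ g1] := gs01 k x Ax.
  by rewrite ler_piMr ?(ltW (half_pow_gt0 _)).
have [k Ck] := Csmall x0 Ax0 _ d0.
(* All later terms are at most [d] at [x0]. With [Sup] this gives [q k * P <= d * q k * (2 - q k)],
   so [P < 2 d = e / 2], against [e <= P]. *)
have : P <= S k x0 + q k * d.
  apply: ge_sup; first by exists (S 0%N x0), 0%N.
  move=> _ [j _ <-]; have [jk|/ltnW kj] := leqP j k.
    rewrite -(subnKC jk); apply: le_trans (Smono j (k - j)%N x0 Ax0) _.
    by rewrite lerDl mulr_ge0 ?(ltW d0)// ltW// half_pow_gt0.
  by rewrite -{1}(subnKC kj); exact: tail.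
have := Sup k x0 Ax0; have := half_pow_gt0 k; rewrite /d in d0 *.
move: (q k) (S k x0) => qk s qk0.
have : 0 <= e / 4 * qk ^+ 2 by rewrite mulr_ge0 ?sqr_ge0// ltW.
nra.
Unshelve. all: by end_near.
Qed.

End convex_sup.

(** * Bounded plurisubharmonic functions *)

Section bpsh_operations.
Context {R : realType}.
Implicit Types W : normedModType R[i].

Lemma bpsh_subset W (G G' : set W) g : G' `<=` G -> bpsh G g -> bpsh G' g.
Proof.
move=> GG' [g01 ug mg]; split; first by move=> z /GG'/g01.
  move=> z /GG'/ug uz e /uz[d d0 gd]; exists d => // w /GG'; exact: gd.
by move=> a b Gab; apply: mg => l /Gab/GG'.
Qed.

Lemma bpsh_midpoint W (G : set W) f g : bpsh G f -> bpsh G g ->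
  bpsh G (fun x => (f x + g x) / 2).
Proof.
move=> pf pg; have [f01 uf mf] := pf; have [g01 ug mg] := pg; split.
- move=> z Gz; have /andP[? ?] := f01 z Gz; have /andP[? ?] := g01 z Gz.
  by apply/andP; split; lra.
- move=> z Gz e e0; have [d d0 hd] := uf z Gz e e0.
  have [d' d'0 hd'] := ug z Gz e e0.
  exists (Num.min d d'); first by rewrite lt_min d0.
  move=> w Gw; rewrite lt_min => /andP[/(hd _ Gw) h /(hd' _ Gw) h']; lra.
- move=> a b Gab.
  have Gab1 (l : R[i]) : rnorm l = 1 -> G (a + l *: b).
    by move=> l1; apply: Gab; rewrite l1.
  have fi := bpsh_circ_int pf Gab1; have gi := bpsh_circ_int pg Gab1.
  rewrite (_ : (fun l => _) = (fun l => 2^-1 * f (a + l *: b)) \+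
     (fun l => 2^-1 * g (a + l *: b))); last first.
    by apply/funext => l /=; rewrite -mulrDr mulrC.
  rewrite cmeanD; [|exact: circ_intZ|exact: circ_intZ].
  rewrite !cmeanZ// -mulrDr mulrC ler_pM2l ?invr_gt0//.
  by rewrite lerD// ?mf ?mg.
Qed.

(** [M] stands for the linear part of [L], so complex discs go to complex discs. This serves both
    restriction to a complex line and composition with a contraction. *)
Lemma bpsh_affine (W W' : normedModType R[i]) (L M : W -> W') (C : R) (G : set W') g :
  (forall a b (l : R[i]), L (a + l *: b) = L a + l *: M b) ->
  (forall w z, rnorm (L w - L z) <= C * rnorm (w - z)) ->
  bpsh G g -> bpsh (L @^-1` G) (g \o L).
Proof.
move=> LM LC [g01 ug mg]; split => /=.
- by move=> z /g01.
- move=> z /= /ug uz e /uz[d d0 hd].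
  have C1 : 0 < `|C| + 1 by rewrite ltr_wpDl.
  exists (d / (`|C| + 1)); first by rewrite divr_gt0.
  move=> w /= Gw; rewrite ltr_pdivlMr// => wz; apply: hd => //.
  apply: le_lt_trans (LC _ _) _; apply: le_lt_trans wz.
  by rewrite mulrC ler_wpM2l ?rnorm_ge0// (le_trans (ler_norm _))// lerDl.
- move=> a b Gab; under eq_fun do rewrite LM.
  by apply: mg => l l1; rewrite -LM; exact: Gab.
Qed.

Section sup_convolution.
Variables (W : normedModType R[i]) (G : set W) (g : W -> R) (K : R).
Hypotheses (pg : bpsh G g) (K0 : 0 < K) (G0 : G !=set0).

Definition supconv z : R := sup [set g w - K * rnorm (z - w) | w in G].

Lemma supconv_ub z w : G w -> g w - K * rnorm (z - w) <= supconv z.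
Proof.
move=> Gw; apply: ub_le_sup; last by exists w.
exists 0 => _ [y Gy <-]; have [g01 _ _] := pg; have /andP[_ ?] := g01 y Gy.
by have := mulr_ge0 (ltW K0) (rnorm_ge0 (z - y)); lra.
Qed.

Lemma supconv_le z M : (forall w, G w -> g w - K * rnorm (z - w) <= M) ->
  supconv z <= M.
Proof.
move=> h; have [w Gw] := G0; apply: ge_sup; first by exists (g w - K * rnorm (z - w)), w.
by move=> _ [y Gy <-]; exact: h.
Qed.

Lemma supconv_le0 z : supconv z <= 0.
Proof.
apply: supconv_le => w Gw; have [g01 _ _] := pg; have /andP[_ ?] := g01 w Gw.
by have := mulr_ge0 (ltW K0) (rnorm_ge0 (z - w)); lra.
Qed.

Lemma le_supconv z : G z -> g z <= supconv z.
Proof. by move=> /(@supconv_ub z); rewrite subrr rnorm0 mulr0 subr0. Qed.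

Lemma supconv_lipschitz z w : supconv w <= supconv z + K * rnorm (w - z).
Proof.
apply: supconv_le => y Gy; have := supconv_ub z Gy.
have : K * rnorm (z - y) <= K * rnorm (w - z) + K * rnorm (w - y).
  rewrite -mulrDr ler_wpM2l ?(ltW K0)// (rnormB w z).
  by have := rnormD (z - w) (w - y); rewrite addrA subrK.
lra.
Qed.

(** At a centre [a], a point [w] farther than [1 / K] contributes less than -1, a lower bound for
    the mean anyway. For nearer [w] the disc translated by [w - a] stays in [G], the distance
    between the two discs is constant, and the submean inequality of [g] applies. *)
Lemma bpsh_supconv (D : set W) :
  (forall z w, D z -> rnorm (w - z) <= K^-1 -> G w) -> bpsh D supconv.
Proof.
move=> DG; have [g01 ug mg] := pg.
have DGs : D `<=` G.
  by move=> z Dz; apply: (DG z) => //; rewrite subrr rnorm0 invr_ge0 ltW.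
have s01 z : D z -> -1 <= supconv z <= 0.
  move=> /DGs Gz; rewrite supconv_le0 andbT.
  by have /andP[? _] := g01 z Gz; apply: le_trans (le_supconv Gz).
have us z : usc_at D supconv z.
  move=> e e0; exists (e / K); first by rewrite divr_gt0.
  move=> w _; rewrite ltr_pdivlMr// => wz.
  have := supconv_lipschitz z w; lra.
split => // a b Dab.
have Dab1 (l : R[i]) : rnorm l = 1 -> D (a + l *: b).
  by move=> l1; apply: Dab; rewrite l1.
have Da : D a by have := Dab 0; rewrite scale0r addr0 rnorm0; apply.
have si : circ_int (fun l => supconv (a + l *: b)).
  apply: (@circ_int_line _ _ D _ 1) => // z Dz.
  by have /andP[? ?] := s01 _ Dz; rewrite ler_norml; lra.
have ci := @circ_int_cst R.
apply: supconv_le => w Gw.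
have [aw|aw] := leP (rnorm (w - a)) K^-1; last first.
  have /andP[_ gw] := g01 w Gw; apply: (@le_trans _ _ (-1)).
    rewrite rnormB; have : 1 < K * rnorm (w - a).
      by rewrite -ltr_pdivrMl// mulr1.
    lra.
  rewrite -[leLHS]cmean_cst; apply: cmean_le => // l l1.
  by have /andP[] := s01 _ (Dab1 _ l1).
have Gwb (l : R[i]) : rnorm l <= 1 -> G (w + l *: b).
  by move=> /Dab Dl; apply: DG Dl _; rewrite opprD addrACA subrr addr0.
have Gwb1 (l : R[i]) : rnorm l = 1 -> G (w + l *: b).
  by move=> l1; apply: Gwb; rewrite l1.
have gi := bpsh_circ_int pg Gwb1.
pose c := - (K * rnorm (a - w)).
apply: (@le_trans _ _ (cmean ((fun l => g (w + l *: b)) \+ (fun=> c)))).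
  by rewrite cmeanD// cmean_cst lerD2r; exact: mg.
apply: cmean_le => //; first exact: circ_intD.
move=> l l1 /=; have := supconv_ub (a + l *: b) (Gwb1 _ l1).
by rewrite opprD addrACA subrr addr0.
Qed.

End sup_convolution.

Lemma usc_onP W (D : set W) (u : W -> \bar R) : usc_on D u <->
  forall z, D z -> forall c : R, (u z < c%:E)%E -> exists2 d : R, 0 < d &
    forall w, D w -> rnorm (w - z) < d -> (u w < c%:E)%E.
Proof.
split.
- move=> uu z Dz c uc.
  have [|U Uz hU] := uu z (- c); first by rewrite EFinN lteN2.
  have : within D (nbhs z) U by rewrite (@nbhs_subspace_in W D z Dz).
  move=> /nbhs_rnormP[d d0 hd].
  exists d => // w Dw wz; have := hU w (hd w wz Dw).
  by rewrite EFinN lteN2.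
- move=> h z a az; have [Dz|nDz] := pselect (D z); last first.
    (* Points outside [D] are isolated in the subspace topology. *)
    exists [set z]; last by move=> _ ->.
    have gz : globally [set z] [set z] by move=> ?.
    by rewrite (@nbhs_subspace_out W D z nDz) in gz; exact: gz.
  have [|d d0 hd] := h z Dz (- a); first by rewrite EFinN lteNr.
  exists [set w | D w /\ rnorm (w - z) < d].
    have dz : within D (@nbhs W W z) [set w : W | D w /\ rnorm (w - z) < d].
      by apply/nbhs_rnormP; exists d => // y yz Dy; split.
    by rewrite (@nbhs_subspace_in W D z Dz) in dz; exact: dz.
  by move=> w [Dw /(hd w Dw)]; rewrite EFinN lteNr.
Qed.

End bpsh_operations.

(** * Passage between extended-real and bounded plurisubharmonic functions *)

Section psh_bpsh.
Context {R : realType} {n : nat}.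
Local Notation V := 'cV[R[i]]_n.
Local Notation mu := (@lebesgue_measure R).
Implicit Types (D : set V) (u : V -> \bar R) (g : V -> R).

(** The final competitors are lowered by a constant to reach -1 on [A], which takes them out of
    [-1, 0]. *)
Lemma psh_bpsh_sub D g (c : R) : bpsh D g -> 0 <= c ->
  psh_nonpos D (fun z => (g z - c)%:E).
Proof.
move=> pg c0; have [g01 ug mg] := pg.
have uD (W : normedModType R[i]) (E : set W) (f : W -> R) : (forall z, E z -> usc_at E f z) ->
    usc_on E (fun z => (f z - c)%:E).
  move=> uf; apply/usc_onP => z Ez r; rewrite lte_fin => fr.
  have e0 : 0 < r - (f z - c) by rewrite subr_gt0.
  have [d d0 hd] := uf z Ez _ e0.
  by exists d => // w Ew /(hd w Ew); rewrite lte_fin; lra.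
split; last first.
  by move=> z Dz; have /andP[_ ?] := g01 z Dz; rewrite lee_fin; lra.
split; first exact: uD ug.
move=> a b Da; split.
- have pab : bpsh [set l : R[i] | D (a + l *: b)] (fun l => g (a + l *: b)).
    apply: (@bpsh_affine R R[i] V (fun l => a + l *: b) (fun l => l *: b) (rnorm b)) pg.
      by move=> x y l; rewrite scalerDl addrA scalerA.
    by move=> w z; rewrite opprD addrACA subrr add0r -scalerBl rnormZ mulrC.
  by apply: uD; case: pab.
- by move=> l _; rewrite ltry.
- move=> l r r0 ldisc.
  have lZ (k : R[i]) : a + (l + r%:C * k) *: b = a + l *: b + k *: (r%:C *: b).
    by rewrite scalerDl addrA scalerA (mulrC k).
  have Dl (k : R[i]) : rnorm k <= 1 -> D (a + l *: b + k *: (r%:C *: b)).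
    move=> k1; rewrite -lZ; apply: ldisc; rewrite /= addrC addKr rnormE lecR.
    by rewrite rnormM rnorm_real gtr0_norm// ler_piMr// ltW.
  have Dl1 (k : R[i]) : rnorm k = 1 -> D (a + l *: b + k *: (r%:C *: b)).
    by move=> k1; apply: Dl; rewrite k1.
  have ci := circ_int_cst (- c).
  have gi := circ_intD (bpsh_circ_int pg Dl1) ci.
  under eq_integral => t _ do rewrite (lZ (cis t)).
  have := mg _ _ Dl; rewrite -(lerD2r (- c)).
  rewrite -[X in _ <= _ + X](cmean_cst (- c)) -cmeanD//; last exact: bpsh_circ_int pg Dl1.
  rewrite -lee_fin /cmean EFinM /Rintegral fineK//.
  by apply: integrable_fin_num => //; exact: gi.
Qed.

Lemma bpsh_truncation D u : psh_nonpos D u ->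
  bpsh D (fun z => fine (maxe (u z) (-1)%:E)).
Proof.
move=> [[uu mu_] u0].
pose g z := fine (maxe (u z) (-1)%:E).
have gE z : D z -> (g z)%:E = maxe (u z) (-1)%:E.
  move=> Dz; rewrite /g fineK// fin_numE; apply/andP; split.
    by rewrite gt_eqF// lt_max ltNyr orbT.
  by rewrite lt_eqF// gt_max (le_lt_trans (u0 z Dz)) ?ltry.
have g01 z : D z -> -1 <= g z <= 0.
  move=> Dz; rewrite -!lee_fin gE// le_max lexx orbT ge_max u0//=.
  by rewrite lee_fin lerN10.
have ug z : D z -> usc_at D g z.
  move=> Dz e e0.
  have [|d d0 hd] := (iffLR (usc_onP D u)) uu z Dz (g z + e).
    rewrite (@le_lt_trans _ _ (g z)%:E)//; last by rewrite lte_fin ltrDl.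
    by rewrite gE// le_max lexx.
  exists d => // w Dw wz; rewrite -lte_fin gE// gt_max hd//= lte_fin.
  by have /andP[? _] := g01 z Dz; lra.
split => // a b Dab.
have Dab1 (l : R[i]) : rnorm l = 1 -> D (a + l *: b).
  by move=> l1; apply: Dab; rewrite l1.
have Da : D a by have := Dab 0; rewrite scale0r addr0 rnorm0; apply.
have gi : circ_int (fun l => g (a + l *: b)).
  apply: (@circ_int_line _ _ D _ 1) => // z Dz.
  by have /andP[? ?] := g01 _ Dz; rewrite ler_norml; lra.
rewrite -lee_fin [leLHS]gE// ge_max; apply/andP; split; last first.
  rewrite lee_fin -[leLHS]cmean_cst; apply: cmean_le => // [|l l1].
    exact: circ_int_cst.
  by have /andP[] := g01 _ (Dab1 _ l1).
have [_ _ /(_ 0 1 ltr01)] := mu_ a b Da.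
rewrite scale0r addr0 => /(_ _)/le_trans; apply.
  move=> l /=; rewrite subr0 rnormE lecR; exact: Dab.
rewrite /cmean EFinM /Rintegral fineK; last first.
  by apply: integrable_fin_num => //; exact: gi.
rewrite lee_wpmul2l ?lee_fin ?invr_ge0 ?mulr_ge0 ?pi_ge0//.
(* [u] may have integral [-oo] on the circle, so the means are compared as integrals of the
   nonnegative functions [- u] and [- g]. *)
pose e (t : R) := (- u (a + cis t *: b)%R)%E.
have me : measurable_fun setT e.
  apply: lower_semicontinuous_measurable => t r re.
  have [|d d0 hd] := (iffLR (usc_onP D u)) uu _ (Dab1 _ (rnorm_cis t)) (- r).
    by rewrite EFinN lteNr.
  have b0 : 0 < rnorm b + 1 by rewrite ltr_wpDl// rnorm_ge0.
  exists [set s | rnorm (cis s - cis t) < d / (rnorm b + 1)].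
    by apply: cis_near; rewrite divr_gt0.
  move=> s st'; have {st'}st : rnorm (cis s - cis t) * (rnorm b + 1) < d.
    by rewrite -(ltr_pdivlMr _ _ b0).
  rewrite /e lteNr -EFinN; apply: hd; first exact: Dab1 (rnorm_cis s).
  rewrite opprD addrACA subrr add0r -scalerBl rnormZ.
  apply: le_lt_trans st.
  by rewrite ler_wpM2l ?rnorm_ge0// lerDl.
have e0 t : (0 <= e t)%E by rewrite /e leeNr oppe0; exact/u0/Dab1/rnorm_cis.
rewrite [leLHS](_ : _ = \int[mu]_(t in `[0%R, (2 * pi)%R]) - e t)%E; last first.
  by apply: eq_integral => t _; rewrite /e oppeK add0r mul1r.
rewrite integral_ge0N// leeNl.
pose m (t : R) := (- (g (a + cis t *: b)%R)%:E)%E.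
rewrite [X in (- X <= _)%E](_ : _ = \int[mu]_(t in `[0%R, (2 * pi)%R]) - m t)%E; last first.
  by apply: eq_integral => t _; rewrite oppeK.
have m0 t : (0 <= m t)%E.
  rewrite /m leeNr oppe0 lee_fin.
  by have /andP[] := g01 _ (Dab1 _ (rnorm_cis t)).
rewrite integral_ge0N// oppeK.
apply: ge0_le_integral => //.
- by apply: measurableT_comp => //; exact: measurable_int gi.
- exact: measurable_funTS.
- by move=> t _; rewrite /m /e leeN2 gE ?le_max ?lexx//; exact/Dab1/rnorm_cis.
Qed.

End psh_bpsh.

(** * Ellipsoids *)

Section hermitian_form.
Local Open Scope sesquilinear_scope.
Context {R : realType} {n : nat}.
Local Notation V := 'cV[R[i]]_n.

Lemma rnorm_sum (I : finType) (F : I -> R[i]) :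
  rnorm (\sum_i F i) <= \sum_i rnorm (F i).
Proof.
elim/big_ind2 : _ => [|x a y b xa yb|//]; first by rewrite rnorm0.
by rewrite (le_trans (rnormD _ _))// lerD.
Qed.

Lemma rnorm_conj (l : R[i]) : rnorm (Num.conj l) = rnorm l.
Proof. by rewrite !rnormCE; case: l => a b /=; rewrite sqrrN. Qed.

Lemma rnorm_sqr_le_sum (v : V) : rnorm v ^+ 2 <= \sum_i rnorm (v i ord0) ^+ 2.
Proof.
have S0 (P : pred 'I_n) : 0 <= \sum_(i | P i) rnorm (v i ord0) ^+ 2.
  by apply: sumr_ge0 => i _; exact: sqr_ge0.
have [v0|/mx_norm_neq0[[i j] /= vE]] := eqVneq (mx_norm v) 0.
  by rewrite /rnorm [`|v|]v0 /= expr0n S0.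
rewrite {1}/rnorm [`|v|]vE (ord1 j) (bigD1 i)//= lerDl; exact: S0.
Qed.

Lemma Re_sqr_norm (v : V) :
  complex.Re ((v^t* *m v) ord0 ord0) = \sum_i rnorm (v i ord0) ^+ 2.
Proof.
rewrite mxE; have -> (F : 'I_n -> R[i]) : complex.Re (\sum_i F i) = \sum_i complex.Re (F i).
  by apply: (big_morph (@complex.Re R)) => // -[? ?] [? ?].
apply: eq_bigr => i _; rewrite !mxE rnormC_sqr.
by case: (v i ord0) => a b /=; ring.
Qed.

Definition mx_entry_sum (m : nat) (M : 'M[R[i]]_(m, n)) : R := \sum_i \sum_j rnorm (M i j).

Lemma mx_entry_sum_ge0 m (M : 'M[R[i]]_(m, n)) : 0 <= mx_entry_sum M.
Proof. by apply: sumr_ge0 => i _; apply: sumr_ge0 => j _; exact: rnorm_ge0. Qed.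

Lemma rnorm_mulmx (m : nat) (M : 'M[R[i]]_(m, n)) (v : V) :
  rnorm (M *m v) <= mx_entry_sum M * rnorm v.
Proof.
apply: le_trans (rnorm_col _) _; rewrite mulr_suml ler_sum// => i _.
rewrite mxE (le_trans (rnorm_sum _))// mulr_suml ler_sum// => j _.
by rewrite rnormM ler_wpM2l ?rnorm_ge0// rnorm_coord.
Qed.

Definition hform (H : 'M[R[i]]_n) (z w : V) : R[i] := (z^t* *m H *m w) ord0 ord0.
Definition qform H (z : V) : R := complex.Re (hform H z z).

Lemma hformDl H z z' w : hform H (z + z') w = hform H z w + hform H z' w.
Proof. by rewrite /hform linearD /= map_mxD !mulmxDl mxE. Qed.

Lemma hformDr H z w w' : hform H z (w + w') = hform H z w + hform H z w'.
Proof. by rewrite /hform mulmxDr mxE. Qed.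

Lemma hformZl H (l : R[i]) z w : hform H (l *: z) w = Num.conj l * hform H z w.
Proof. by rewrite /hform linearZ /= map_mxZ -!scalemxAl mxE. Qed.

Lemma hformZr H (l : R[i]) z w : hform H z (l *: w) = l * hform H z w.
Proof. by rewrite /hform -scalemxAr mxE. Qed.

Lemma rnorm_hform H z w : rnorm (hform H z w) <= mx_entry_sum H * rnorm z * rnorm w.
Proof.
rewrite /hform -mulmxA mxE (le_trans (rnorm_sum _))//.
rewrite /mx_entry_sum !mulr_suml ler_sum// => i _.
rewrite !mxE rnormM rnorm_conj.
apply: (@le_trans _ _ (rnorm z * rnorm (\sum_j H i j * w j ord0))).
  by rewrite ler_wpM2r ?rnorm_ge0// rnorm_coord.
rewrite mulrAC [_ * rnorm z]mulrC ler_wpM2l ?rnorm_ge0//.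
rewrite (le_trans (rnorm_sum _))// mulr_suml ler_sum// => j _.
by rewrite rnormM ler_wpM2l ?rnorm_ge0// rnorm_coord.
Qed.

Section positive_definite.
Variable H : 'M[R[i]]_n.
Hypothesis Hpos : posdef H.
Local Notation q := (qform H).
Local Notation C := (mx_entry_sum H).

Lemma hermE : H^t* = H.
Proof.
have [/is_hermitianmxP Hh _] := Hpos.
by rewrite [in RHS]Hh expr0 scale1r.
Qed.

Lemma hform_conj z w : hform H w z = Num.conj (hform H z w).
Proof.
have -> : Num.conj (hform H z w) = ((z^t* *m H *m w)^t*) ord0 ord0.
  by rewrite /hform; move: (_ *m w) => M; rewrite !mxE.
have zz : z^t*^t* = z by apply/colP => i; rewrite !mxE conjCK.
by rewrite !trmx_mul !map_mxM /= hermE zz mulmxA.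
Qed.

Lemma Re_hformC z w : complex.Re (hform H w z) = complex.Re (hform H z w).
Proof. by rewrite hform_conj; case: (hform H z w). Qed.

Lemma hform_real z : hform H z z = (q z)%:C.
Proof.
rewrite /qform; have := hform_conj z z; case: (hform H z z) => a b [] bb /=.
by congr (_ +i* _); lra.
Qed.

Lemma qformD z w : q (z + w) = q z + 2 * complex.Re (hform H z w) + q w.
Proof.
rewrite /qform hformDl !hformDr; have := Re_hformC z w.
case: (hform H z z) => a b; case: (hform H z w) => c d; case: (hform H w w) => e f.
by case: (hform H w z) => g h /= ->; ring.
Qed.

Lemma qformZ (l : R[i]) z : q (l *: z) = rnorm l ^+ 2 * q z.
Proof.
rewrite /qform hformZl hformZr hform_real rnormC_sqr.
by case: l => a b /=; ring.
Qed.

Lemma qform_ge0 z : 0 <= q z.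
Proof.
have [->|z0] := eqVneq z 0.
  by rewrite -(scale0r (0 : V)) qformZ rnorm0 expr0n mul0r.
have [_ /(_ z z0)] := Hpos; rewrite -/(hform H z z) hform_real ltcR => /ltW.
exact.
Qed.

Lemma qform_gt0 z : z != 0 -> 0 < q z.
Proof.
by move=> z0; have [_ /(_ z z0)] := Hpos; rewrite -/(hform H z z) hform_real ltcR.
Qed.

Lemma qform_le z : q z <= C * rnorm z ^+ 2.
Proof.
rewrite expr2 mulrA; apply: le_trans (rnorm_hform _ _ _).
exact: le_trans (ler_norm _) (Re_le_rnorm _).
Qed.

Lemma ellipsoidE z : ellipsoid H z <-> q z < 1.
Proof.
rewrite /ellipsoid /= -/(hform H z z) hform_real -[1]/(1%:C); split.
  by rewrite ltcR.
by rewrite ltcR.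
Qed.

(** Young's inequality for the form: expand [q (s z - w) >= 0] and divide by [s]. *)
Lemma qformD_le (s : R) z w : 0 < s -> q (z + w) <= (1 + s) * q z + (1 + s^-1) * q w.
Proof.
move=> s0; have := qform_ge0 (s%:C *: z + (-1) *: w).
rewrite (qformD (s%:C *: z)) !qformZ hformZl hformZr rnorm_real gtr0_norm//.
rewrite rnormCE /= oppr0 expr0n addr0 sqrrN expr1n sqrtr1 expr1n mul1r.
have -> : complex.Re (Num.conj s%:C * (-1 * hform H z w)) = - s * complex.Re (hform H z w).
  by case: (hform H z w) => a b /=; ring.
rewrite qformD; move: (complex.Re _) (q z) (q w) => x a b h.
have : 0 <= s^-1 * (s ^+ 2 * a + 2 * (- s * x) + b).
  by rewrite mulr_ge0// invr_ge0 ltW.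
have -> : s^-1 * (s ^+ 2 * a + 2 * (- s * x) + b) = s * a - 2 * x + s^-1 * b.
  by field; rewrite gt_eqF.
lra.
Qed.

Lemma continuous_qform : continuous (q : V -> R).
Proof.
apply: rnorm_continuous => z e e0.
have z0 := rnorm_ge0 z; have C0 := mx_entry_sum_ge0 H.
have M0 : 0 < C * (2 * rnorm z + 1) + 1 by rewrite ltr_wpDl// mulr_ge0//; lra.
exists (Num.min 1 (e / (C * (2 * rnorm z + 1) + 1))).
  by rewrite lt_min ltr01 divr_gt0.
move=> w; rewrite lt_min ltr_pdivlMr// => /andP[w1 we].
have -> : q w = q (z + (w - z)) by rewrite addrC subrK.
rewrite qformD; set h := w - z in w1 we *.
have h0 := rnorm_ge0 h.
have hz : `|complex.Re (hform H z h)| <= C * rnorm z * rnorm h.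
  exact: le_trans (Re_le_rnorm _) (rnorm_hform _ _ _).
have qh : q h <= C * rnorm h.
  rewrite (le_trans (qform_le _))// ler_wpM2l// expr2 ler_piMr// ltW//.
have := qform_ge0 h; move: hz qh we h0 z0; rewrite ler_norml ltr_norml.
move: (complex.Re _) (q h) (q z) (rnorm h) (rnorm z) => x a b r s.
by move=> /andP[x1 x2] *; apply/andP; split; nra.
Qed.

Lemma open_ellipsoid : open (ellipsoid H).
Proof.
have -> : ellipsoid H = q @^-1` [set x | x < 1].
  by apply/seteqP; split => z /ellipsoidE.
by apply: open_comp; [move=> z _; exact: continuous_qform|exact: open_lt].
Qed.

Lemma closure_ellipsoid z : closure (ellipsoid H) z -> q z <= 1.
Proof.
have c : closed [set z : V | q z <= 1].
  have -> : [set z : V | q z <= 1] = q @^-1` [set x | x <= 1] by [].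
  by apply: preimage_closed; [move=> ? _; exact: continuous_qform|exact: closed_le].
move=> Dz; suff : [set z : V | q z <= 1] z by [].
rewrite ((closure_id _).1 c); apply: closure_subset Dz => w /ellipsoidE/ltW.
exact.
Qed.

Lemma boundary_ellipsoid z : boundary (ellipsoid H) z -> q z = 1.
Proof.
move=> [/closure_ellipsoid z1]; have /interior_id -> := open_ellipsoid.
move=> nz; apply/eqP; rewrite eq_le z1 /= leNgt; apply/negP => z2.
by apply: nz; apply/ellipsoidE.
Qed.

Lemma qform_radial_contraction (t : R) : 0 < t < 1 ->
  exists2 k : R, 0 < k < 1 & forall z, q (z - t%:C *: (1%:M *m z)) <= k * q z.
Proof.
move=> /andP[t0 t1]; exists ((1 - t) ^+ 2).
  by rewrite exprn_gt0 ?subr_gt0//= exprn_ilt1//; lra.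
move=> z; rewrite mul1mx -[X in X - _]scale1r -scalerBl qformZ.
by rewrite -[1](rmorph1 (real_complex R)) -rmorphB rnorm_real/= real_normK// num_real.
Qed.

(** With [w = H z] and [E] the Euclidean square of [w], [q (z - t w) = q z - 2 t E + t^2 q w]. For
    small [t] the last term is at most [t E], and invertibility of [H] bounds [q z] by [C3 E],
    leaving the factor [1 - t / C3]. *)
Lemma qform_normal_contraction : exists2 t0 : R, 0 < t0 &
  forall t : R, 0 < t < t0 ->
  exists2 k : R, 0 < k < 1 & forall z, q (z - t%:C *: (H *m z)) <= k * q z.
Proof.
have C0 := mx_entry_sum_ge0 H.
have Hinj (z : V) : H *m z = 0 -> z = 0.
  move=> Hz; have [//|z0] := eqVneq z 0.
  have := qform_gt0 z0.
  by rewrite /qform /hform -mulmxA Hz mulmx0 mxE ltxx.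
(* [kermx] is a left kernel while [Hinj] is about columns, hence the transposes. *)
have Hu : H \in unitmx.
  rewrite -unitmx_tr -row_free_unit -kermx_eq0; apply/eqP/row_matrixP => i.
  rewrite row0; apply: trmx_inj; rewrite trmx0; apply: Hinj.
  rewrite -[H in H *m _]trmxK -trmx_mul; apply/eqP; rewrite trmx_eq0; apply/eqP.
  by rewrite -row_mul mulmx_ker row0.
pose C2 := mx_entry_sum (invmx H); have C20 : 0 <= C2 by exact: mx_entry_sum_ge0.
pose C3 := C * C2 ^+ 2 + 1; have C30 : 0 < C3.
  by apply: ltr_wpDl => //; apply: mulr_ge0 => //; exact: sqr_ge0.
have C40 : 0 < C + 1 by exact: ltr_wpDl.
(* The first bound gives [t * q w <= E], the second keeps [1 - t / C3] positive. *)
exists (Num.min (1 / (C + 1)) C3); first by rewrite lt_min C30 andbT divr_gt0.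
move=> t /andP[t0]; rewrite lt_min => /andP[tC tC3].
have {}tC : t * (C + 1) < 1 by rewrite -(ltr_pdivlMr _ _ C40).
exists (1 - t / C3).
  have : 0 < t / C3 by rewrite divr_gt0.
  have : t / C3 < 1 by rewrite ltr_pdivrMr// mul1r.
  by move=> *; apply/andP; split; lra.
move=> z; pose w := H *m z.
pose E := \sum_i rnorm (w i ord0) ^+ 2.
have qz : q z <= C3 * rnorm w ^+ 2.
  have zw : rnorm z <= C2 * rnorm w by rewrite -{1}(mulKmx Hu z); exact: rnorm_mulmx.
  apply: le_trans (qform_le z) _; rewrite mulrDl mul1r ler_wpDr ?sqr_ge0//.
  rewrite -mulrA ler_wpM2l// -exprMn ler_pXn2r// ?nnegrE ?mulr_ge0// ?rnorm_ge0//.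
have wE : rnorm w ^+ 2 <= E by exact: rnorm_sqr_le_sum.
have zHw : complex.Re (hform H z w) = E.
  by rewrite /hform -{1}hermE -map_mxM -trmx_mul Re_sqr_norm.
rewrite -scaleNr -rmorphN qformD qformZ hformZr rnorm_real normrN real_normK ?num_real//.
have -> : complex.Re ((- t)%:C * hform H z w) = - t * E.
  by rewrite -zHw; case: (hform H z w) => a b /=; ring.
have qw : t * q w <= E.
  apply: le_trans wE; apply: le_trans (ler_wpM2l (ltW t0) (qform_le w)) _.
  by rewrite mulrA ler_piMl ?sqr_ge0//; nra.
have tE : t ^+ 2 * q w <= t * E by rewrite expr2 -mulrA ler_wpM2l// ltW.
have qE : t / C3 * q z <= t * E.
  rewrite -mulrA ler_wpM2l ?(ltW t0)// mulrC ler_pdivrMr// mulrC.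
  by apply: le_trans qz _; rewrite ler_wpM2l// ltW.
move: tE qE; rewrite (mulrBl (q z)) mul1r.
move: (t ^+ 2 * q w) (t / C3 * q z) (q z) => a b c h1 h2; clear -h1 h2; lra.
Qed.

End positive_definite.
End hermitian_form.

(** * Comparison of the extremal functions *)

Lemma limf_esup_leP {R : realType} (T : choiceType) (X : filteredType T) (f : X -> \bar R)
    (F : set_system X) (a : R) : Filter F ->
  (limf_esup f F <= a%:E)%E <->
  forall e : R, 0 < e -> \forall x \near F, (f x <= (a + e)%:E)%E.
Proof.
move=> FF; rewrite limf_esupE; split.
- move=> fa e e0.
  have : (ereal_inf [set ereal_sup (f @` U) | U in F] < (a + e)%:E)%E.
    by rewrite (le_lt_trans fa)// lte_fin ltrDl.
  move=> /ereal_inf_lt[_ [U FU <-] Ua]; apply: filterS FU => x Ux.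
  by apply: le_trans (ltW Ua); apply: ereal_sup_ubound; exists x.
- move=> h; apply/lee_addgt0Pr => e e0; rewrite -EFinD.
  apply: le_trans (ereal_inf_lbound _) _; first by exists [set x | (f x <= (a + e)%:E)%E]; [exact: h|].
  by apply: ge_ereal_sup => _ [x /= xe <-].
Qed.

(** A Lebesgue number argument: half of the radius at [x] serves all points within that half of
    [x]. *)
Lemma compact_uniform_radius {R : realType} (W : normedModType R[i]) (A : set W)
    (P : set W) : compact A ->
  (forall x, A x -> exists2 d : R, 0 < d & forall w, rnorm (w - x) < d -> P w) ->
  exists2 d : R, 0 < d & forall x, A x -> forall w, rnorm (w - x) < d -> P w.
Proof.
move=> /compact_near_coveringP cA AP.
pose Q (d : R) (x : W) := forall w, rnorm (w - x) < d -> P w.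
have := cA R (0 : R)^'+ Q _.
have /[swap]/[apply] : forall x, A x -> \forall x' \near x & i \near (0 : R)^'+, Q i x'.
  move=> x /AP[d d0 hd]; have d20 : 0 < d / 2 by rewrite divr_gt0.
  exists ([set x' | rnorm (x' - x) < d / 2], [set i | i < d / 2]) => /=.
    split; first by apply/nbhs_rnormP; exists (d / 2).
    exact: nbhs_right_lt.
  move=> [x' i] [/= xx' id] w wx; apply: hd.
  have := rnormD (w - x') (x' - x); rewrite addrA subrK; lra.
move=> near0.
have [d [d0 hd]] : exists d : R, 0 < d /\ A `<=` Q d.
  apply: (@filter_ex _ (0 : R)^'+); apply: filterI; [exact: nbhs_right_gt|exact: near0].
by exists d.
Qed.

(** * Continuous competitors obtained from contractions *)

Section contraction_maps.
Context {R : realType} {n : nat}.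
Local Notation V := 'cV[R[i]]_n.
Variables (H : 'M[R[i]]_n) (A : set V).
Hypotheses (Hpos : posdef H) (cA : compact A) (Abd : A `<=` boundary (ellipsoid H)).
Local Notation q := (qform H).
Local Notation D := (ellipsoid H).
Let C := mx_entry_sum H.

Let Aq x : A x -> q x = 1.
Proof. by move=> /Abd; exact: boundary_ellipsoid. Qed.

Let shift (B : 'M[R[i]]_n) (t : R) (x : V) : V := x - t%:C *: (B *m x).

Lemma bpsh_ellipsoid_le (rho e : R) (g : V -> R) z : 0 < e -> 1 < rho ->
  bpsh [set x | q x < rho] g -> (forall x, A x -> g x <= -1 + e) -> D z ->
  ((g z - 2 * e)%:E <= omega_c z A D)%E.
Proof.
move=> e0 rho1 pg gA Dz; have [g01 ug _] := pg.
have C0 : 0 <= C by exact: mx_entry_sum_ge0.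
have q0 x := qform_ge0 Hpos x.
have [d d0 hd] : exists2 d : R, 0 < d & forall x, A x -> forall w,
    rnorm (w - x) < d -> q w < rho -> g w <= -1 + 2 * e.
  apply: (@compact_uniform_radius _ _ _ (fun w => q w < rho -> g w <= -1 + 2 * e)) => // x Ax.
  have [|d d0 hd] := ug x _ e e0; first by rewrite /= Aq.
  exists d => // w wx qw; have := hd w qw wx; have := gA x Ax; lra.
(* Chosen so that [1 + 2 s = rho]: one [s] pays for Young's inequality, the other for the
   displacement by [1 / K]. *)
pose s := (rho - 1) / 2; have s0 : 0 < s by rewrite divr_gt0// subr_gt0.
pose c := (1 + s^-1) * C.
have c0 : 0 <= c by rewrite mulr_ge0// addr_ge0// invr_ge0 ltW.
(* [1 <= K * d] makes points at distance at least [d] from [x] contribute at most -1 to the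
   sup-convolution; [c < K * s] and [1 <= K] keep the [1 / K]-neighbourhood of the ellipsoid inside
   [q < rho]. *)
have [K [K0 K1 Kd Ks]] : exists K : R, [/\ 0 < K, 1 <= K, 1 <= K * d & c < K * s].
  have di0 : 0 < d^-1 by rewrite invr_gt0.
  have cs0 : 0 < (c + 1) / s by rewrite divr_gt0// ltr_wpDl.
  have Xs : (c + 1) / s * s = c + 1 by rewrite divfK// gt_eqF.
  have dd : d^-1 * d = 1 by rewrite mulVf// gt_eqF.
  move: cs0 Xs di0 dd; move: ((c + 1) / s) d^-1 => X Y X0 Xs Y0 Yd.
  by exists (1 + Y + X); split; nra.
have G0 : [set x | q x < rho] !=set0.
  by exists 0; rewrite /= -(scale0r (0 : V)) qformZ// rnorm0 expr0n mul0r; lra.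
have DG x w : D x -> rnorm (w - x) <= K^-1 -> q w < rho.
  move=> /(ellipsoidE Hpos) x1 wx; rewrite -(subrK x w) addrC.
  apply: le_lt_trans (qformD_le Hpos _ _ s0) _.
  have h1 : (1 + s) * q x <= 1 + s by rewrite ler_piMr ?ltW//; lra.
  have h2 : (1 + s^-1) * q (w - x) <= c * K^-1 ^+ 2.
    rewrite /c -(mulrA (1 + s^-1)); apply: ler_wpM2l.
      by rewrite addr_ge0// invr_ge0 ltW.
    apply: le_trans (@qform_le _ _ _ _) _; rewrite ler_wpM2l//.
    by rewrite ler_pXn2r// nnegrE ?rnorm_ge0// invr_ge0 ltW.
  have h3 : c * K^-1 ^+ 2 < s.
    rewrite expr2 mulrA ltr_pdivrMr//; apply: (@le_lt_trans _ _ c).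
      by rewrite ler_piMr// invf_le1.
    by rewrite mulrC.
  have : 1 + s + s = rho by rewrite /s; field.
  lra.
have pS := bpsh_supconv pg K0 G0 DG.
have qz : q z < rho by rewrite (lt_trans _ rho1)//; exact/ellipsoidE.
apply: (@le_trans _ _ (supconv [set x | q x < rho] g K z - 2 * e)%:E).
  by rewrite lee_fin lerD2r le_supconv.
apply: ereal_sup_ubound.
exists (fun x => supconv [set x | q x < rho] g K x - 2 * e) => //; split.
- by apply: psh_bpsh_sub pS _; rewrite mulr_ge0// ltW.
- apply: continuous_subspaceT; apply: (@lipschitz_continuous _ _ K) => x y.
  by rewrite [leRHS]addrAC lerD2r; exact: supconv_lipschitz.
- move=> x Ax; rewrite lerBlDr; apply: supconv_le => // w qw.
  have Kx := mulr_ge0 (ltW K0) (rnorm_ge0 (x - w)).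
  have [wx|wx] := ltP (rnorm (w - x)) d; first by have := hd x Ax w wx qw; lra.
  have /andP[_ ?] := g01 w qw.
  have : K * d <= K * rnorm (x - w) by rewrite rnormB ler_wpM2l// ltW.
  lra.
Qed.

Lemma shift_linear (B : 'M[R[i]]_n) t a b (l : R[i]) :
  shift B t (a + l *: b) = shift B t a + l *: shift B t b.
Proof.
rewrite /shift mulmxDr -scalemxAr scalerBr !scalerDr !scalerA (mulrC l).
by rewrite opprD addrACA.
Qed.

Lemma shift_lipschitz (B : 'M[R[i]]_n) (t : R) w z :
  rnorm (shift B t w - shift B t z) <= (1 + `|t| * mx_entry_sum B) * rnorm (w - z).
Proof.
have -> : shift B t w - shift B t z = (w - z) - t%:C *: (B *m (w - z)).
  rewrite /shift mulmxBr scalerBr.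
  move: (t%:C *: (B *m w)) (t%:C *: (B *m z)) => a b.
  by rewrite opprD opprK addrACA opprB [b - a]addrC.
apply: le_trans (rnormD _ _) _; rewrite mulrDl mul1r lerD2l rnormN rnormZ rnorm_real.
by rewrite -mulrA ler_wpM2l// rnorm_mulmx.
Qed.

Lemma le_omega_c_of_contraction (B : 'M[R[i]]_n) (t0 : R) (u : V -> \bar R) z :
  0 < t0 ->
  (forall t : R, 0 < t < t0 ->
    exists2 k : R, 0 < k < 1 & forall x, q (shift B t x) <= k * q x) ->
  psh_nonpos D u ->
  (forall x, A x -> forall e : R, 0 < e -> exists2 t1 : R, 0 < t1 &
    forall t, 0 < t < t1 -> (u (shift B t x) <= (-1 + e)%:E)%E) ->
  D z -> (u z <= omega_c z A D)%E.
Proof.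
move=> t00 contr pu uA Dz; have [_ u0] := pu.
have pg := bpsh_truncation pu; set g := fun z => fine _ in pg.
have [g01 ug _] := pg.
have uzg : (u z <= (g z)%:E)%E.
  rewrite /g fineK ?le_max ?lexx// fin_numE; apply/andP; split.
    by rewrite gt_eqF// lt_max ltNyr orbT.
  by rewrite lt_eqF// gt_max (le_lt_trans (u0 z Dz)) ?ltry.
apply: le_trans uzg _; apply/lee_addgt0Pr => e' e'0.
(* One [e] is lost at [z] in the choice of [g'], two in [bpsh_ellipsoid_le]. *)
pose e := e' / 3; have e0 : 0 < e by rewrite divr_gt0.
suff : ((g z - 3 * e)%:E <= omega_c z A D)%E.
  have -> : 3 * e = e' by rewrite /e; field.
  by rewrite -leeBlDr.
(* Instead of coefficients of a convex combination of the [g \o shift B t] with [t < 1 / (k + 1)],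
   the fourth condition records what it inherits on [A]: every common upper bound. This passes
   directly to midpoints, while [rho] may shrink but stays above 1. Adding 1 moves the values on [A]
   into [0, 1]. *)
pose Ck k := [set h : V -> R | exists g' (rho : R), [/\ 1 < rho,
    bpsh [set x | q x < rho] g', g z - e <= g' z,
    forall x c, A x -> (forall t, 0 < t < k.+1%:R^-1 -> g (shift B t x) <= c) -> g' x <= c &
    h = fun x => g' x + 1]].
have Ck0 k : Ck k !=set0.
  (* The real points [t] of this complex line are the [shift B t z], so [segment_nonthin] prevents
     [g] from staying below [g z - e] at all small [t > 0]. *)
  pose v (l : R[i]) := g (z + l *: - (B *m z)).
  have pv : bpsh [set l : R[i] | D (z + l *: - (B *m z))] v.
    apply: (@bpsh_affine _ R[i] V (fun l => z + l *: - (B *m z))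
      (fun l => l *: - (B *m z)) (rnorm (B *m z))) pg.
      by move=> x y l; rewrite scalerDl addrA scalerA.
    by move=> x y; rewrite opprD addrACA subrr add0r -scalerBl rnormZ rnormN mulrC.
  have [d d0 Dd] : exists2 d : R, 0 < d & forall y, rnorm (y - z) < d -> D y.
    by apply/nbhs_rnormP; apply: open_nbhs_nbhs; split => //; exact: open_ellipsoid.
  have B0 : 0 < rnorm (B *m z) + 1 by rewrite ltr_wpDl// rnorm_ge0.
  have k0 : 0 < (k.+1%:R : R)^-1 by rewrite invr_gt0.
  pose s := Num.min (d / (rnorm (B *m z) + 1)) (Num.min t0 k.+1%:R^-1) / 2.
  have m0 : 0 < Num.min (d / (rnorm (B *m z) + 1)) (Num.min t0 k.+1%:R^-1).
    by rewrite !lt_min divr_gt0//= t00 k0.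
  have s0 : 0 < s by rewrite divr_gt0.
  have : s < Num.min (d / (rnorm (B *m z) + 1)) (Num.min t0 k.+1%:R^-1).
    by rewrite /s; lra.
  rewrite !lt_min => /andP[sd /andP[st0 sk]].
  have [t /andP[tp ts] gt] : exists2 t : R, 0 < t <= s & g z - e <= v t%:C.
    apply: contrapT => hn.
    have Gs (l : R[i]) : rnorm l <= s -> D (z + l *: - (B *m z)).
      move=> ls; apply: Dd; rewrite addrC addKr rnormZ rnormN.
      move: sd; rewrite ltr_pdivlMr// => sd; apply: le_lt_trans sd.
      by rewrite ler_pM ?rnorm_ge0 ?lerDl.
    have vs t : 0 < t <= s -> v t%:C <= g z - e.
      by move=> ts; rewrite leNgt; apply/negP => /ltW ?; apply: hn; exists t.
    have := segment_nonthin pv s0 Gs vs.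
    by rewrite /v scale0r addr0 lerBrDr gerDl leNgt e0.
  have tt0 : 0 < t < t0 by rewrite tp (le_lt_trans ts).
  have [kap /andP[kap0 kap1] hkap] := contr t tt0.
  (* The contraction factor [kap] sends [q < 1 / kap] into the ellipsoid. *)
  exists (fun x => g (shift B t x) + 1), (g \o shift B t), kap^-1; split => //.
  - by rewrite invf_gt1.
  - apply: bpsh_subset (bpsh_affine (@shift_linear B t) (@shift_lipschitz B t) pg).
    move=> x /= qx; apply/(ellipsoidE Hpos); apply: le_lt_trans (hkap x) _.
    by rewrite mulrC -ltr_pdivlMr// mul1r.
  - by move: gt; rewrite /v scalerN.
  - move=> x c Ax gc; apply: (gc t); rewrite tp; exact: le_lt_trans sk.
have [||||h [g' [rho [rho1 pg' gz _ ->]]] hA] := @convex_dini _ _ A Ck cA Ck0 _ _ _ _ e e0.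
- move=> k h [g' [rho [rho1 pg' gz gA ->]]]; exists g', rho; split => //.
  move=> x c Ax gc; apply: gA => // t /andP[tp tk]; apply: gc; rewrite tp.
  by rewrite (lt_le_trans tk)// lef_pV2 ?posrE// ler_nat.
- move=> h [g' [rho [rho1 pg' gz gA ->]]]; have [g'01 ug' _] := pg'; split.
    move=> x Ax r r0; have [|d d0 hd] := ug' x _ r r0; first by rewrite /= Aq.
    apply/nbhs_rnormP; exists d => // w wx Aw.
    by rewrite addrAC ltrD2r hd//= Aq.
  move=> x Ax; have /andP[? ?] : -1 <= g' x <= 0 by apply: g'01; rewrite /= Aq.
  by apply/andP; split; lra.
- move=> k _ _ [f [rho [rho1 pf fz fA ->]]] [f' [rho' [rho1' pf' fz' fA' ->]]].
  exists (fun x => (f x + f' x) / 2), (Num.min rho rho'); split.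
  + by rewrite lt_min rho1.
  + by apply: bpsh_midpoint; [apply: bpsh_subset pf|apply: bpsh_subset pf'] => x /=;
      rewrite lt_min => /andP[].
  + lra.
  + by move=> x c Ax gc; have := fA x c Ax gc; have := fA' x c Ax gc; lra.
  + by apply/funext => x; field.
- move=> x Ax r r0; have [t1 t10 ht1] := uA x Ax r r0.
  have [k hk] : exists k : nat, k.+1%:R^-1 < t1.
    have [k _ /(_ k (leqnn k))] := near_infty_natSinv_lt (PosNum t10).
    by exists k.
  exists k => _ [f [rho [rho1 pf fz fA ->]]].
  suff : f x <= -1 + r by lra.
  apply: fA => // t /andP[tp tk].
  have ut : (u (shift B t x) <= (-1 + r)%:E)%E.
    by apply: ht1; rewrite tp (lt_trans tk).
  rewrite /g -lee_fin fineK.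
    by rewrite ge_max ut lee_fin lerDl ltW.
  rewrite fin_numE; apply/andP; split.
    by rewrite gt_eqF// lt_max ltNyr orbT.
  by rewrite lt_eqF// gt_max (le_lt_trans ut) ?ltry.
have := @bpsh_ellipsoid_le rho e g' z e0 rho1 pg' _ Dz.
have g'A x : A x -> g' x <= -1 + e by move=> /hA; lra.
by move=> /(_ g'A); apply: le_trans; rewrite lee_fin; lra.
Qed.

End contraction_maps.

Lemma within_rnormP {R : realType} (W : normedModType R[i]) (D U : set W) x :
  within D (nbhs x) U <-> exists2 d : R, 0 < d &
    forall y, rnorm (y - x) < d -> D y -> U y.
Proof. exact: nbhs_rnormP. Qed.

Lemma near_all (T : topologicalType) (x : T) (P : T -> Prop) :
  (forall y, P y) -> \forall y \near x, P y.
Proof. exact: nearW. Qed.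

(** * The inequalities between the four extremal functions *)

Section comparison.
Local Open Scope sesquilinear_scope.
Context {R : realType} {n : nat}.
Local Notation V := 'cV[R[i]]_n.
Variables (H : 'M[R[i]]_n) (A : set V).
Hypotheses (Hpos : posdef H) (cA : compact A) (Abd : A `<=` boundary (ellipsoid H)).
Local Notation q := (qform H).
Local Notation D := (ellipsoid H).

Lemma omega_c_le_omega z : (omega_c z A D <= omega z A D)%E.
Proof.
apply: le_ereal_sup => _ [u [pu cu uA] <-]; exists (EFin \o u) => //; split => //.
move=> x Ax; apply/limf_esup_leP => e e0.
have Dx : closure D x by have [] := Abd Ax.
have /subspace_continuousP/(_ x Dx)/cvgrPdist_lt/(_ e e0) := cu.
move=> /within_rnormP[d d0 hd]; apply/within_rnormP; exists d => // y yx Dy.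
have := hd y yx (subset_closure Dy); rewrite ltr_norml => /andP[h _].
by rewrite lee_fin ltW// (lt_le_trans (_ : u y < u x + e)) ?lerD2r ?uA// -ltrBlDl -ltrN2 opprB.
Qed.

Lemma omega_le_omega_n z : (omega z A D <= omega_n z A D)%E.
Proof.
apply: le_ereal_sup => _ [u [pu uA] <-]; exists u => //; split => // x Ax.
apply/limf_esup_leP => e e0.
have /limf_esup_leP/(_ e e0)/within_rnormP[d d0 hd] := uA x Ax.
by apply/within_rnormP; exists d => // y yx [Dy _]; exact: hd.
Qed.

Lemma ellipsoid_radius (r : R) x : A x -> 0 < r < 1 -> D (r%:C *: x).
Proof.
move=> /Abd/(boundary_ellipsoid Hpos) x1 /andP[r0 r1]; apply/(ellipsoidE Hpos).
by rewrite qformZ// x1 mulr1 rnorm_real gtr0_norm// expr2 mulr_ilt1// ltW.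
Qed.

Lemma omega_le_omega_R z : (omega z A D <= omega_R z A D)%E.
Proof.
apply: le_ereal_sup => _ [u [pu uA] <-]; exists u => //; split => // x Ax.
apply/limf_esup_leP => e e0.
have /limf_esup_leP/(_ e e0)/within_rnormP[d d0 hd] := uA x Ax.
have x0 : 0 < rnorm x + 1 by rewrite ltr_wpDl// rnorm_ge0.
have dx0 : 0 < d / (rnorm x + 1) by rewrite divr_gt0.
near=> r; have r0 : 0 < r by near: r; exact: nbhs_left_gt.
have r1 : r < 1 by near: r; exact: nbhs_left_lt.
have rd : 1 - r < d / (rnorm x + 1).
  by rewrite ltrBlDr -ltrBlDl; near: r; apply: nbhs_left_gt; rewrite ltrBlDr ltrDl.
apply: hd; last by apply: ellipsoid_radius => //; rewrite r0.
rewrite -[X in _ - X]scale1r -scalerBl rnormZ.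
rewrite -(rmorph1 (real_complex R)) -rmorphB rnorm_real/= distrC gtr0_norm ?subr_gt0//.
move: rd; rewrite ltr_pdivlMr//; apply: le_lt_trans.
by rewrite ler_wpM2l ?lerDl// subr_ge0 ltW.
Unshelve. all: by end_near.
Qed.

Lemma omega_R_le_omega_c z : D z -> (omega_R z A D <= omega_c z A D)%E.
Proof.
move=> Dz; apply: ge_ereal_sup => _ [u [pu uA] <-].
apply: (@le_omega_c_of_contraction _ _ H A Hpos cA Abd 1%:M 1 u z) => //.
  by move=> t /(qform_radial_contraction Hpos).
move=> x Ax e e0.
have /limf_esup_leP/(_ e e0)/nbhs_ballP[d /= d0 hd] := uA x Ax.
exists d => // t /andP[t0 td].
have -> : x - t%:C *: (1%:M *m x) = (1 - t)%:C *: x.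
  by rewrite mul1mx rmorphB rmorph1 scalerBl scale1r.
apply: hd; last by rewrite gtrBl.
by rewrite /ball /= opprB addrC subrK gtr0_norm.
Qed.

(** [q - 1] is a global defining function with gradient [2 H y]; the remainder of its first-order
    expansion is exactly [q h], of second order in [h]. Thus the orbit of [x] under [1 - tH] runs
    along the normal. *)
Lemma inward_normalP x (t : R) : A x -> 0 < t ->
  inward_normal D x (x - t%:C *: (H *m x)).
Proof.
move=> Ax t0; have x1 := boundary_ellipsoid Hpos (Abd Ax).
exists (fun y => q y - 1), (fun y => 2%:C *: (H *m y)); split; last first.
  (* Halved to compensate the factor 2 of the gradient. *)
  exists (t / 2); first by rewrite divr_gt0.
  by rewrite scalerA -rmorphM /= divfK.
have C0 := mx_entry_sum_ge0 H.
have C1 : 0 < mx_entry_sum H + 1 by rewrite ltr_wpDl.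
split.
- apply: near_all => y U /nbhs_rnormP[e e0 hU].
  apply: (iffRL (@within_rnormP _ V (fun h => h != 0) _ 0)).
  exists (e / (mx_entry_sum H + 1)); first by rewrite divr_gt0.
  move=> h he h0; apply: hU.
  have -> : q (y + h) - 1 - (q y - 1) -
      complex.Re (((2%:C *: (H *m y))^t* *m h) ord0 ord0) = q h.
    have -> : ((2%:C *: (H *m y))^t* *m h) ord0 ord0 = 2%:C * hform H y h.
      rewrite /hform linearZ /= map_mxZ -scalemxAl mxE trmx_mul map_mxM /= hermE//.
      by congr (_ * _); apply/eqP; rewrite eq_complex /= oppr0 !eqxx.
    rewrite qformD//; case: (hform H y h) => a b /=; ring.
  rewrite subr0 rnormM rnormV rnorm_real rnormE rnorm_real.
  rewrite (ger0_norm (rnorm_ge0 _)) ger0_norm ?qform_ge0//.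
  have hn0 : 0 < rnorm h.
    rewrite lt_def rnorm_ge0 andbT; apply: contra h0 => /eqP/rnorm0_eq ->.
    by rewrite eqxx.
  rewrite ltr_pdivrMr//; apply: le_lt_trans (@qform_le _ _ H h) _.
  rewrite expr2 mulrA ltr_pM2r//.
  move: he; rewrite subr0 ltr_pdivlMr//; apply: le_lt_trans.
  by rewrite mulrC ler_wpM2l ?lerDl// ltW.
- apply: near_all => y U /nbhs_rnormP[e e0 hU].
  apply/nbhs_rnormP; exists (e / (2 * mx_entry_sum H + 1)).
    by rewrite divr_gt0// ltr_wpDl// mulr_ge0.
  move=> w; rewrite ltr_pdivlMr; last by rewrite ltr_wpDl// mulr_ge0.
  move=> we; apply: hU; rewrite -scalerBr -mulmxBr rnormZ rnorm_real normr_nat.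
  apply: le_lt_trans we; rewrite mulrC mulrDr mulr1.
  have := rnorm_mulmx H (w - y); have := rnorm_ge0 (w - y); lra.
- by rewrite x1 subrr.
- apply/eqP => /eqP; rewrite scaler_eq0 => /orP[|/eqP Hx].
    by rewrite (_ : 2%:C = 2%:R) ?pnatr_eq0// rmorph_nat.
  move: x1; rewrite /qform /hform -mulmxA Hx mulmx0 mxE /= => /esym/eqP.
  by rewrite oner_eq0.
- by apply: near_all => y; rewrite ellipsoidE// subr_lt0.
Qed.

Lemma omega_n_le_omega_c z : D z -> (omega_n z A D <= omega_c z A D)%E.
Proof.
move=> Dz; apply: ge_ereal_sup => _ [u [pu uA] <-].
have [t0 t00 contr] := qform_normal_contraction Hpos.
apply: (@le_omega_c_of_contraction _ _ H A Hpos cA Abd H t0 u z) => // x Ax e e0.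
have /limf_esup_leP/(_ e e0)/within_rnormP[d d0 hd] := uA x Ax.
have h0 : 0 < rnorm (H *m x) + 1 by rewrite ltr_wpDl// rnorm_ge0.
exists (Num.min t0 (d / (rnorm (H *m x) + 1))); first by rewrite lt_min t00 divr_gt0.
move=> t /andP[tp]; rewrite lt_min => /andP[tt0 td].
apply: hd.
  rewrite addrC addKr rnormN rnormZ rnorm_real gtr0_norm//.
  move: td; rewrite ltr_pdivlMr//; apply: le_lt_trans.
  by rewrite ler_wpM2l ?lerDl// ltW.
split; last exact: inward_normalP.
have [|k /andP[k0 k1] hk] := contr t; first by rewrite tp.
apply/(ellipsoidE Hpos); apply: le_lt_trans (hk x) _.
by rewrite (boundary_ellipsoid Hpos (Abd Ax)) mulr1.
Qed.

End comparison.

Theorem theorem3p7 (R : realType) (n : nat) (n_gt0 : (0 < n)%N)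
    (H : 'M[R[i]]_n) (Hpos : posdef H)
    (A : set 'cV[R[i]]_n) (cA : compact A)
    (Abd : A `<=` boundary (ellipsoid H))
    (z : 'cV[R[i]]_n) (Dz : ellipsoid H z) :
  [/\ omega z A (ellipsoid H) = omega_n z A (ellipsoid H),
      omega_n z A (ellipsoid H) = omega_R z A (ellipsoid H) &
      omega_R z A (ellipsoid H) = omega_c z A (ellipsoid H)].
Proof.
have c_w := omega_c_le_omega Abd z.
have w_n := omega_le_omega_n H A z.
have w_R := omega_le_omega_R Hpos Abd z.
have n_c := omega_n_le_omega_c Hpos cA Abd Dz.
have R_c := omega_R_le_omega_c Hpos cA Abd Dz.
have n_w : omega_n z A (ellipsoid H) = omega z A (ellipsoid H).
  by apply/eqP; rewrite eq_le w_n (le_trans n_c c_w).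
have R_w : omega_R z A (ellipsoid H) = omega z A (ellipsoid H).
  by apply/eqP; rewrite eq_le w_R (le_trans R_c c_w).
rewrite n_w R_w; split => //; apply/eqP.
by rewrite eq_le c_w (le_trans w_n n_c).
Qed.
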